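(* For the (strongly) convex-concave saddle-point problem $$\min_{x\in\mathcal X}\max_{y\in\mathcal Y}\;\mu\omega_{\mathcal X}(x)+r(x)+\Psi(x,y)-g(y)-\rho\,\omega_{\mathcal Y}(y),\qquad\mu>0,\ \rho>0,$$ and any $\eta>0$, the dual inexact accelerated proximal gradient (APG) method (described in the context) finds a primal-dual pair $(x,y)\in\mathcal X\times\mathcal Y$ with duality gap $\Delta(x,y)\le\eta$ with dual gradient complexity $$\bar C_{\mathrm d}(\eta)=O\left(\left(\sqrt{\frac{L_{yy}}{\rho}}+\frac{L_{xy}}{\sqrt{\mu\rho}}\right)\ln\left(\frac1{\eta\rho}\right)\right)$$ and primal gradient complexity $$\bar C_{\mathrm p}(\eta)=O\left(\left(\sqrt{\frac{L_{yy}}{\rho}}+\frac{L_{xy}}{\sqrt{\mu\rho}}\right)\sqrt{\frac{L'_{xx}}{\mu}}\;\ln^2\left(\frac1{\eta\rho}\right)\right).$$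
   Context: Setting. $\mathbb X,\mathbb Y$ are finite-dimensional real normed spaces (dual norms $\|\cdot\|_*$). $r:\mathbb X\to\mathbb R\cup\{+\infty\}$ is closed convex with $\mathcal X:=\operatorname{dom}r$ nonempty, closed, convex; $\mathcal Y\subseteq\mathbb Y$ is nonempty, convex, compact; $g:\mathcal Y\to\mathbb R$ is convex and continuous. $\mathcal X'\supseteq\mathcal X$, $\mathcal Y'\supseteq\mathcal Y$ are open. $\Psi:\mathcal X'\times\mathcal Y'\to\mathbb R$ is jointly continuous, convex in $x$ on $\mathcal X$ for each $y\in\mathcal Y$, concave in $y$ on $\mathcal Y$ for each $x\in\mathcal X$; $\Psi(\cdot,y)$ is differentiable on $\mathcal X'$ for $y\in\mathcal Y$, $\Psi(x,\cdot)$ is differentiable on $\mathcal Y'$ for $x\in\mathcal X$, and for $x,x'\in\mathcal X$, $y,y'\in\mathcal Y$: $\|\nabla_x\Psi(x,y)-\nabla_x\Psi(x',y)\|_*\le L'_{xx}\|x-x'\|$, $\|\nabla_x\Psi(x,y)-\nabla_x\Psi(x,y')\|_*\le L_{xy}\|y-y'\|$, $\|\nabla_y\Psi(x,y)-\nabla_y\Psi(x',y)\|_*\le L_{xy}\|x-x'\|$, $\|\nabla_y\Psi(x,y)-\nabla_y\Psi(x,y')\|_*\le L_{yy}\|y-y'\|$. A distance generating function (DGF) on a nonempty closed convex $\mathcal U\subseteq\mathbb U$ is $\omega_{\mathcal U}:\mathbb U\to\mathbb R\cup\{+\infty\}$ continuous and 1-strongly convex on $\mathcal U$ and essentially smooth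 (continuously differentiable on $\operatorname{int}\operatorname{dom}\omega_{\mathcal U}$ with gradient norms blowing up at the boundary of the domain). $\mathcal U^o:=\mathcal U\cap\operatorname{int}\operatorname{dom}\omega_{\mathcal U}$, $D_{\omega_{\mathcal U}}(u',u):=\omega_{\mathcal U}(u')-\omega_{\mathcal U}(u)-\langle\nabla\omega_{\mathcal U}(u),u'-u\rangle$. $\omega_{\mathcal X},\omega_{\mathcal Y}$ are DGFs on $\mathcal X,\mathcal Y$; $\omega_{\mathcal X}$ is moreover twice continuously differentiable on $\operatorname{int}\operatorname{dom}\omega_{\mathcal X}\supseteq\mathcal X$ with $\beta_{\mathcal X}$-Lipschitz gradient on $\mathcal X$. The problems $\min_{u\in\mathcal U}\varphi(u)+\langle\xi,u\rangle+\alpha^{-1}\omega_{\mathcal U}(u)$ ($\alpha>0$) with $(\mathcal U,\varphi)=(\mathcal X,r),(\mathcal Y,g)$ have unique, easily computable solutions in $\mathcal U^o$. Let $\bar f(x):=\max_{y\in\mathcal Y}\Psi(x,y)-g(y)-\rho\omega_{\mathcal Y}(y)$, $\psi^{\mathrm P}(x,y):=\Psi(x,y)+r(x)+\mu\omega_{\mathcal X}(x)$, $\pi(y):=\min_{x\in\mathcal X}\psi^{\mathrm P}(x,y)$, $p(x):=\bar f(x)+r(x)+\mu\omega_{\mathcal X}(x)$, $d(y):=\pi(y)-g(y)-\rho\omega_{\mathcal Y}(y)$, $\Delta(x,y):=p(x)-d(y)$, $L_\pi:=L_{yy}+L_{xy}^2/\mu$. Algorithm 2 (APG) for $\min_{u\in\mathcal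 U}h(u)+\zeta(u)+m\,\omega_{\mathcal U}(u)$, $m>0$, with parameter $\bar L$: $\theta:=m/\bar L$, $\alpha_0=1$, $\alpha_t=(1+\sqrt\theta)^{t-1}\sqrt\theta$ ($t\ge1$), $A_t=\sum_{i\le t}\alpha_i$, $\tau_t=\alpha_t/A_t$; $u_0\in\mathcal U^o$, $s_0=\hat\nabla h(u_0)$, $z_0=\arg\min_{u\in\mathcal U}\langle s_0,u\rangle+\zeta(u)+m\omega_{\mathcal U}(u)+\bar LD_{\omega_{\mathcal U}}(u,u_0)$; for $t\ge0$: $\bar u_{t+1}=\arg\min_{u\in\mathcal U}\langle s_t,u\rangle+A_t(\zeta(u)+m\omega_{\mathcal U}(u))+\bar LD_{\omega_{\mathcal U}}(u,u_0)$; $u_{t+1}=(1-\tau_{t+1})z_t+\tau_{t+1}\bar u_{t+1}$; compute an approximate gradient $\hat\nabla h(u_{t+1})$; $s_{t+1}=s_t+\alpha_{t+1}\hat\nabla h(u_{t+1})$; $w_{t+1}=\arg\min_{u\in\mathcal U}\alpha_{t+1}(\langle\hat\nabla h(u_{t+1}),u\rangle+\zeta(u)+m\omega_{\mathcal U}(u))+(A_tm+\bar L)D_{\omega_{\mathcal U}}(u,\bar u_{t+1})$; $z_{t+1}=(1-\tau_{t+1})z_t+\tau_{t+1}w_{t+1}$. Dual inexact APG method: apply Algorithm 2 to $\min_{y\in\mathcal Y}-d(y)$ with $h=-\pi$, $\zeta=g$, $m=\rho$, $\bar L=2L_\pi$, start $y_0\in\mathcal Y^o$, query points $y_t$ (in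 the role of $u_t$), output iterates $\tilde y_t$ (in the role of $z_t$), and approximate gradients $-\nabla_y\Psi(\hat x(y_t),y_t)$, where $\hat x(y_t)\in\mathcal X$ satisfies $\psi^{\mathrm P}(\hat x(y_t),y_t)-\pi(y_t)\le\bar\epsilon/2$ with $\bar\epsilon=\eta/(2(1+\sqrt{2L_\pi/\rho}))$. Each $\hat x(y_t)$ is obtained by Algorithm 2 applied to $\min_{x\in\mathcal X}\psi^{\mathrm P}(x,y_t)$ with $h=\Psi(\cdot,y_t)$, $\zeta=r$, $m=\mu$, $\bar L=L'_{xx}$, exact gradients, start $x_0\in\mathcal X$. The primal output is $\bar x_t:=A_t^{-1}\sum_{i=0}^t\alpha_i\hat x(y_i)$, the dual output $\tilde y_t$. The primal (dual) gradient complexity is the total number of evaluations of $\nabla_x\Psi$ (of $\nabla_y\Psi$). The $O(\cdot)$ bounds refer to small $\eta,\rho$; the quantities $\max_{y\in\mathcal Y}D_{\omega_{\mathcal Y}}(y,y_0)$, $\sup_{y\in\mathcal Y}D_{\omega_{\mathcal X}}(x^*(y),x_0)$ (with $x^*(y):=\arg\min_{x\in\mathcal X}\psi^{\mathrm P}(x,y)$) and the smoothness constants appearing inside logarithms are suppressed. *)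

(* Defs.v *)
From HB Require Import structures.
From mathcomp Require Import all_boot all_order all_algebra.
From mathcomp Require Import all_classical all_reals all_analysis.

Set Implicit Arguments.
Unset Strict Implicit.
Unset Printing Implicit Defensive.

Import Order.TTheory GRing.Theory Num.Theory.
Import numFieldNormedType.Exports.

Local Open Scope classical_set_scope.
Local Open Scope ring_scope.

Section ConvexAnalysis.
Context {R : realType} {U : normedModType R}.

Definition finite_dimensional : Prop :=
  exists (n : nat) (e : 'I_n -> U),
    forall u : U, exists c : 'I_n -> R, u = \sum_(i < n) c i *: e i.

(* Meant for linear functionals; on a finite-dimensional space these are
   bounded on the unit ball, so the real-valued [sup] is the true supremum. *)
Definition dual_norm (l : U -> R) : R :=
  sup [set `|l v| | v in [set v : U | `|v| <= 1]].

(* Gradients are elements of the dual space: [grad f u v] is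
   <nabla f(u), v>. *)
Definition grad (f : U -> R) (u : U) : U -> R := 'd (f : U -> R^o) u.

Definition is_argmin (C : set U) (f : U -> R) (u : U) : Prop :=
  C u /\ forall v, C v -> f u <= f v.

(* Functions U -> R u {+oo} are maps into \bar R that avoid -oo. *)
Definition avoids_minfty (f : U -> \bar R) : Prop := forall u, f u != -oo%E.

Definition dom (f : U -> \bar R) : set U := [set u | (f u < +oo)%E].

(* The product 0 * +oo is 0 in \bar R, so t = 0 and t = 1 are harmless. *)
Definition econvex (f : U -> \bar R) : Prop :=
  forall (u v : U) (t : R), 0 <= t <= 1 ->
    (f (t *: u + (1 - t) *: v)%R <= t%:E * f u + (1 - t)%:E * f v)%E.

(* Strong convexity with modulus 1 *)
Definition strongly_convex1 (C : set U) (f : U -> R) : Prop :=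
  forall (u v : U) (t : R), C u -> C v -> 0 <= t <= 1 ->
    f (t *: u + (1 - t) *: v) <=
      t * f u + (1 - t) * f v - t * (1 - t) / 2 * `|u - v| ^+ 2.

Definition C1_on (O : set U) (f : U -> R) : Prop :=
  forall u, O u ->
    differentiable (f : U -> R^o) u /\
    dual_norm (fun h => grad f v h - grad f u h) @[v --> u] --> (0 : R).

(* In finite dimension the gradient map is C^1 iff all its components
   u |-> <nabla f(u), h> are. *)
Definition C2_on (O : set U) (f : U -> R) : Prop :=
  C1_on O f /\ forall h : U, C1_on O (fun u => grad f u h).

Definition lipschitz_grad_on (C : set U) (f : U -> R) (L : R) : Prop :=
  forall u u', C u -> C u' ->
    dual_norm (fun h => grad f u h - grad f u' h) <= L * `|u - u'|.

Definition essentially_smooth (w : U -> \bar R) : Prop :=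
  [/\ interior (dom w) !=set0,
      C1_on (interior (dom w)) (fine \o w) &
      forall b, closure (dom w) b -> ~ interior (dom w) b ->
        dual_norm (grad (fine \o w) v) @[v --> within (interior (dom w)) (nbhs b)]
          --> +oo].

Definition is_dgf (C : set U) (w : U -> \bar R) : Prop :=
  [/\ avoids_minfty w,
      C `<=` dom w,
      {within C, continuous (fine \o w : U -> R)},
      strongly_convex1 C (fine \o w) &
      essentially_smooth w].

(* The set written U^o *)
Definition dgf_interior (C : set U) (w : U -> \bar R) : set U :=
  C `&` interior (dom w).

Definition bregman (w : U -> \bar R) (u' u : U) : R :=
  fine (w u') - fine (w u) - grad (fine \o w) u (u' - u).

Definition prox_solvable (C : set U) (phi : U -> R) (w : U -> \bar R) : Prop :=
  forall (xi : {linear U -> R^o}) (alpha : R), 0 < alpha ->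
    exists u, [/\ is_argmin C (fun v => phi v + xi v + alpha^-1 * fine (w v)) u,
                  dgf_interior C w u &
                  forall u', is_argmin C
                    (fun v => phi v + xi v + alpha^-1 * fine (w v)) u' ->
                    u' = u].

End ConvexAnalysis.

Arguments finite_dimensional {R} U.

Section APG.
Context {R : realType} {U : normedModType R}.

Definition apg_alpha (theta : R) (t : nat) : R :=
  if t is t'.+1 then (1 + Num.sqrt theta) ^+ t' * Num.sqrt theta else 1.

Definition apg_A (theta : R) (t : nat) : R := \sum_(i < t.+1) apg_alpha theta i.

Definition apg_tau (theta : R) (t : nat) : R :=
  apg_alpha theta t / apg_A theta t.

(* The values [apg_ubar 0] and [apg_w 0] are not part of the algorithm. *)
Record apg_iterates := ApgIterates {
  apg_u : nat -> U;
  apg_ubar : nat -> U;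
  apg_w : nat -> U;
  apg_z : nat -> U }.

Fixpoint apg_s (theta : R) (G : nat -> U -> R) (t : nat) : U -> R :=
  if t is t'.+1
  then fun v => apg_s theta G t' v + apg_alpha theta t * G t v
  else G 0%N.

(* [G t] is the (approximate) gradient of h at the query point [apg_u a t]. *)
Definition is_apg (C : set U) (zeta : U -> R) (w : U -> \bar R) (m L : R)
    (u0 : U) (G : nat -> U -> R) (a : apg_iterates) : Prop :=
  let theta := m / L in
  let al := apg_alpha theta in
  let A := apg_A theta in
  let tau := apg_tau theta in
  let s := apg_s theta G in
  [/\ apg_u a 0 = u0,
      is_argmin C
        (fun v => s 0%N v + zeta v + m * fine (w v) + L * bregman w v u0)
        (apg_z a 0) &
      forall t : nat,
        [/\ is_argmin C
              (fun v => s t v + A t * (zeta v + m * fine (w v))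
                        + L * bregman w v u0)
              (apg_ubar a t.+1),
            apg_u a t.+1 =
              (1 - tau t.+1) *: apg_z a t + tau t.+1 *: apg_ubar a t.+1,
            is_argmin C
              (fun v => al t.+1 * (G t.+1 v + zeta v + m * fine (w v))
                        + (A t * m + L) * bregman w v (apg_ubar a t.+1))
              (apg_w a t.+1) &
            apg_z a t.+1 =
              (1 - tau t.+1) *: apg_z a t + tau t.+1 *: apg_w a t.+1]].

End APG.

Arguments apg_iterates {R} U.

Record saddle_problem (R : realType) (X Y : normedModType R) := SaddleProblem {
  Xset : set X;
  Yset : set Y;
  Xopen : set X;              (* the open set X' *)
  Yopen : set Y;              (* the open set Y' *)
  rfun : X -> \bar R;
  gfun : Y -> R;              (* only its values on [Yset] matter *)
  Psi : X -> Y -> R;          (* only its values on X' x Y' matter *)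
  omegaX : X -> \bar R;
  omegaY : Y -> \bar R;
  Lxx : R;                    (* the constant L'_xx *)
  Lxy : R;
  Lyy : R;
  betaX : R;
  mu : R;
  rho : R }.

Section SaddleProblem.
Context {R : realType} {X Y : normedModType R} (P : saddle_problem X Y).

Record saddle_assumptions : Prop := SaddleAssumptions {
  finite_dimX : finite_dimensional X;
  finite_dimY : finite_dimensional Y;
  Xset_neq0 : Xset P !=set0;
  Xset_closed : closed (Xset P);
  Xset_convex : convex_set (Xset P : set (convex_lmodType X));
  Yset_neq0 : Yset P !=set0;
  Yset_compact : compact (Yset P);
  Yset_convex : convex_set (Yset P : set (convex_lmodType Y));
  r_avoids : avoids_minfty (rfun P);
  r_closed : lower_semicontinuous (rfun P);
  r_convex : econvex (rfun P);
  r_dom : dom (rfun P) = Xset P;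
  g_convex : convex_function (Yset P : set (convex_lmodType Y)) (gfun P);
  g_continuous : {within Yset P, continuous (gfun P)};
  Xopen_open : open (Xopen P);
  Yopen_open : open (Yopen P);
  Xset_sub : Xset P `<=` Xopen P;
  Yset_sub : Yset P `<=` Yopen P;
  Psi_continuous : {within Xopen P `*` Yopen P,
    continuous (fun z : X * Y => Psi P z.1 z.2)};
  Psi_convex : forall y, Yset P y ->
    convex_function (Xset P : set (convex_lmodType X)) (Psi P ^~ y);
  Psi_concave : forall x, Xset P x ->
    convex_function (Yset P : set (convex_lmodType Y)) (fun y => - Psi P x y);
  Psi_diffx : forall x y, Xopen P x -> Yset P y ->
    differentiable ((Psi P ^~ y) : X -> R^o) x;
  Psi_diffy : forall x y, Xset P x -> Yopen P y ->
    differentiable (Psi P x : Y -> R^o) y;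
  Lxx_ge0 : 0 <= Lxx P;
  Lxy_ge0 : 0 <= Lxy P;
  Lyy_ge0 : 0 <= Lyy P;
  Psi_lip_xx : forall y, Yset P y ->
    lipschitz_grad_on (Xset P) (Psi P ^~ y) (Lxx P);
  Psi_lip_xy : forall x y y', Xset P x -> Yset P y -> Yset P y' ->
    dual_norm (fun h => grad (Psi P ^~ y) x h - grad (Psi P ^~ y') x h)
      <= Lxy P * `|y - y'|;
  Psi_lip_yx : forall x x' y, Xset P x -> Xset P x' -> Yset P y ->
    dual_norm (fun h => grad (Psi P x) y h - grad (Psi P x') y h)
      <= Lxy P * `|x - x'|;
  Psi_lip_yy : forall x, Xset P x ->
    lipschitz_grad_on (Yset P) (Psi P x) (Lyy P);
  omegaX_dgf : is_dgf (Xset P) (omegaX P);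
  omegaY_dgf : is_dgf (Yset P) (omegaY P);
  Xset_int : Xset P `<=` interior (dom (omegaX P));
  omegaX_C2 : C2_on (interior (dom (omegaX P))) (fine \o omegaX P);
  omegaX_lip : lipschitz_grad_on (Xset P) (fine \o omegaX P) (betaX P);
  prox_solvableX : prox_solvable (Xset P) (fine \o rfun P) (omegaX P);
  prox_solvableY : prox_solvable (Yset P) (gfun P) (omegaY P);
  mu_gt0 : 0 < mu P;
  rho_gt0 : 0 < rho P }.

(* All functions below are used at points of [Xset P] and [Yset P] only, where
   [rfun P], [omegaX P] and [omegaY P] are finite. *)
Definition psiP (x : X) (y : Y) : R :=
  Psi P x y + fine (rfun P x) + mu P * fine (omegaX P x).

(* Under [saddle_assumptions], for x in [Xset P] and y in [Yset P], the supremum and the infimum are attained. *)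
Definition fbar (x : X) : R :=
  sup [set Psi P x y - gfun P y - rho P * fine (omegaY P y) | y in Yset P].

Definition dual_pi (y : Y) : R := inf [set psiP x y | x in Xset P].

Definition primal_value (x : X) : R :=
  fbar x + fine (rfun P x) + mu P * fine (omegaX P x).

Definition dual_value (y : Y) : R :=
  dual_pi y - gfun P y - rho P * fine (omegaY P y).

Definition duality_gap (x : X) (y : Y) : R := primal_value x - dual_value y.

Definition Lpi : R := Lyy P + Lxy P ^+ 2 / mu P.

Definition inner_accuracy (eta : R) : R :=
  eta / (2 * (1 + Num.sqrt (2 * Lpi / rho P))).

(* The t-th inner run solves the subproblem at the query point y_t and is
   stopped after producing its iterate of index [inner_stop t]. *)
Record dual_apg_run := DualApgRun {
  outer_run : apg_iterates Y;
  inner_run : nat -> apg_iterates X;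
  inner_stop : nat -> nat }.

Definition query (a : dual_apg_run) (t : nat) : Y := apg_u (outer_run a) t.

Definition xhat (a : dual_apg_run) (t : nat) : X :=
  apg_z (inner_run a t) (inner_stop a t).

(* Each inner run stops at its first iterate with the required accuracy. *)
Definition is_dual_apg (eta : R) (x0 : X) (y0 : Y) (a : dual_apg_run) : Prop :=
  [/\ is_apg (Yset P) (gfun P) (omegaY P) (rho P) (2 * Lpi) y0
        (fun t v => - grad (Psi P (xhat a t)) (query a t) v) (outer_run a),
      forall t, is_apg (Xset P) (fine \o rfun P) (omegaX P) (mu P) (Lxx P) x0
        (fun k => grad (Psi P ^~ (query a t)) (apg_u (inner_run a t) k))
        (inner_run a t),
      forall t, psiP (xhat a t) (query a t) - dual_pi (query a t)
                  <= inner_accuracy eta / 2 &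
      forall t k, (k < inner_stop a t)%N ->
        inner_accuracy eta / 2 <
          psiP (apg_z (inner_run a t) k) (query a t) - dual_pi (query a t)].

Definition primal_output (a : dual_apg_run) (t : nat) : X :=
  let theta := rho P / (2 * Lpi) in
  (apg_A theta t)^-1 *: \sum_(i < t.+1) apg_alpha theta i *: xhat a i.

Definition dual_output (a : dual_apg_run) (t : nat) : Y :=
  apg_z (outer_run a) t.

(* The accelerated iterate of index t uses the gradients at the t + 1 query
   points of indices 0, ..., t. *)
Definition dual_evals (a : dual_apg_run) (t : nat) : nat := t.+1.

Definition primal_evals (a : dual_apg_run) (t : nat) : nat :=
  (\sum_(i < t.+1) (inner_stop a i).+1)%N.

(* The condition number sqrt(L_yy / rho) + L_xy / sqrt(mu rho) *)
Definition cond_dual : R :=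
  Num.sqrt (Lyy P / rho P) + Lxy P / Num.sqrt (mu P * rho P).

(* Upper bounds for max_y D(y, y_0) and sup_y D(x^*(y), x_0) *)
Definition dual_radius_le (y0 : Y) (M : R) : Prop :=
  forall y, Yset P y -> bregman (omegaY P) y y0 <= M.

Definition primal_radius_le (x0 : X) (M : R) : Prop :=
  forall y xs, Yset P y -> is_argmin (Xset P) (psiP ^~ y) xs ->
    bregman (omegaX P) xs x0 <= M.

End SaddleProblem.

Arguments dual_apg_run {R} X Y.

(* Main.v *)
Require Import Defs.
From HB Require Import structures.
From mathcomp Require Import all_boot all_order all_algebra.
From mathcomp Require Import all_classical all_reals all_analysis.
From mathcomp Require Import ring lra.

Set Implicit Arguments.
Unset Strict Implicit.
Unset Printing Implicit Defensive.

Import Order.TTheory GRing.Theory Num.Theory.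
Import numFieldNormedType.Exports.

Local Open Scope classical_set_scope.
Local Open Scope ring_scope.

(** Two facts carry the theorem.

    The first is an estimate for the accelerated method run with an inexact
    oracle ([apg_estimate]).  Suppose that at each query point u_t an affine
    function ell_t satisfies ell_t <= h <= ell_t + (L / 2) |. - u_t|^2 + eps on
    the feasible set.  Then A_t times the objective value at the iterate z_t
    stays below the running model, which is the sum of the alpha_i ell_i plus
    A_t times the simple part of the objective plus L times the Bregman
    distance to the start, up to an error eps (A_0 + ... + A_t).  The algorithm
    minimises this model exactly, and the weights grow like
    A_t = (1 + sqrt theta)^t, just slowly enough for the strong convexity of
    the subproblems to absorb the quadratic term of the oracle.  Since the A_i
    grow geometrically, the average error is at most (1 + 1 / sqrt theta) eps.

    The second fact is that an inexact solution of the inner problem yields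
    such an oracle for minus the dual function [dual_pi] ([inexact_oracle]):
    if x is (e / 2)-optimal for psiP(., y), then the gradient of Psi(x, .) at y
    gives an oracle with constant 2 Lpi and error e.  Concavity in y provides
    one inequality; the other comes from the quadratic growth of psiP(., y)
    around its minimiser and Young's inequality.

    For the duality gap, the affine models are bounded by - psiP(xhat_i, .)
    and averaged by Jensen's inequality, so that the estimate bounds the
    primal value at the averaged point directly ([duality_gap_le]): the gap is
    at most 2 Lpi M / A_t + eta / 2, where the inner accuracy is chosen so that
    the accumulated errors amount to eta / 2.  The number of outer steps is
    therefore logarithmic in Lpi M / eta with factor
    1 + sqrt (2 Lpi / rho), and Lpi / rho <= cond_dual^2.  The inner runs are
    the case of exact gradients and need a number of steps logarithmic in the
    inverse of the inner accuracy, with factor 1 + sqrt (Lxx / mu).  For small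
    eta and rho all these logarithms are below ln (1 / (eta rho)).

    The minimiser of psiP(., y) used throughout exists because psiP(., y) is
    strongly convex, lower semicontinuous and bounded below on a closed subset
    of a finite-dimensional, hence complete, space. *)

(** * Convexity on a set *)

Section Convexity.
Context {R : realType} {U : normedModType R}.
Implicit Types (C : set U) (f g : U -> R) (u v : U).

(** Real weights in place of bundled scalars of the unit interval make these
    inequalities accessible to linear arithmetic. *)
Definition cvx_set C := forall u v (t : R), C u -> C v -> 0 <= t <= 1 ->
  C (t *: u + (1 - t) *: v).

Definition cvx_on C f := forall u v (t : R), C u -> C v -> 0 <= t <= 1 ->
  f (t *: u + (1 - t) *: v) <= t * f u + (1 - t) * f v.

Lemma convex_set_cvx C : convex_set (C : set (convex_lmodType U)) -> cvx_set C.
Proof.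
move=> CC u v t Cu Cv /andP[t0 t1].
have := CC u v (Itv01 t0 t1); rewrite !inE; exact.
Qed.

Lemma convex_function_cvx C f :
  convex_function (C : set (convex_lmodType U)) f -> cvx_on C f.
Proof.
move=> Cf u v t Cu Cv /andP[t0 t1].
have := Cf (Itv01 t0 t1) u v; rewrite !inE; exact.
Qed.

Lemma strongly_convex_cvx C f : strongly_convex1 C f -> cvx_on C f.
Proof.
move=> Cf u v t Cu Cv t01; apply: le_trans (Cf u v t Cu Cv t01) _.
case/andP: t01 => t0 t1.
rewrite gerBl// mulr_ge0 ?sqr_ge0// divr_ge0// mulr_ge0 ?subr_ge0//.
Qed.

Lemma cvx_onD C f g : cvx_on C f -> cvx_on C g -> cvx_on C (fun v => f v + g v).
Proof.
move=> Cf Cg u v t Cu Cv t01.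
have := lerD (Cf u v t Cu Cv t01) (Cg u v t Cu Cv t01); lra.
Qed.

Lemma cvx_onZ C f (a : R) : 0 <= a -> cvx_on C f -> cvx_on C (fun v => a * f v).
Proof.
move=> a0 Cf u v t Cu Cv t01.
have := ler_wpM2l a0 (Cf u v t Cu Cv t01); lra.
Qed.

Lemma segmentE u v (l : R) : l *: v + (1 - l) *: u = u + l *: (v - u).
Proof. by rewrite scalerBl scale1r scalerBr addrC -addrA [-_ + _]addrC. Qed.

Lemma cvx_segment C u v l : cvx_set C -> C u -> C v -> 0 <= l <= 1 ->
  C (u + l *: (v - u)).
Proof. by move=> CC Cu Cv l01; rewrite -segmentE; exact: CC. Qed.

End Convexity.

(** * Gradients, first-order inequalities and dual norms *)

Section Gradient.
Context {R : realType} {U : normedModType R}.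
Implicit Types (C : set U) (f g : U -> R) (u v d : U).

Lemma gradD f u v d : grad f u (v + d) = grad f u v + grad f u d.
Proof. exact: linearD. Qed.

Lemma gradB f u v d : grad f u (v - d) = grad f u v - grad f u d.
Proof. exact: linearB. Qed.

Lemma gradZ f u d (a : R) : grad f u (a *: d) = a * grad f u d.
Proof. exact: linearZ. Qed.

(** The one-sided form of differentiability along a ray that is needed to pass
    to the limit in inequalities between difference quotients. *)
Lemma grad_dir f u d (e : R) : differentiable (f : U -> R^o) u -> 0 < e ->
  exists2 l0 : R, 0 < l0 & forall l, 0 < l <= l0 ->
    `|f (u + l *: d) - f u - l * grad f u d| <= e * l.
Proof.
move=> df e0.
have := diff_derivable (v := d) df; rewrite /derivable => dd.
have : (fun h : R => h^-1 *: (((f : U -> R^o) \o shift u) (h *: d) - f u)) h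
   @[h --> 0^'] --> grad f u d.
  by rewrite /grad -deriveE.
move=> /cvgrPdist_le/(_ e e0).
rewrite /dnbhs /within/= => /nbhs_norm0P[/= r r0 H].
exists (r / 2) => [|l /andP[l0 lr]]; first by rewrite divr_gt0.
have lN0 : l != 0 by rewrite gt_eqF.
have := H l; rewrite /= gtr0_norm// => /(_ _ lN0).
have lr' : l < r by lra.
move=> /(_ lr'); rewrite distrC [l *: d + u]addrC => K.
have -> : f (u + l *: d) - f u - l * grad f u d =
  l * (l^-1 *: (f (u + l *: d) - f u) - grad f u d).
  by rewrite mulrBr -[in RHS]/(l^-1 * _) mulrA divff// mul1r.
by rewrite normrM gtr0_norm// mulrC ler_pM2r.
Qed.

(** Divide the increments by l and let l tend to 0: the second-order term
    disappears, so that c may be 0 for convex functions and half a squared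
    distance for strongly convex ones. *)
Lemma grad_le f u d (B c : R) : differentiable (f : U -> R^o) u ->
  (forall l : R, 0 < l <= 1 -> f (u + l *: d) - f u <= l * B + l ^+ 2 * c) ->
  grad f u d <= B.
Proof.
move=> df H; apply/ler_addgt0Pr => e e0.
have [l0 l00 K] := grad_dir d df (divr_gt0 e0 (ltr0n R 2)).
pose c' := `|c| + 1.
have c'0 : 0 < c' by rewrite ltr_wpDl.
pose l := Num.min (Num.min 1 l0) (e / 2 / c').
have e2 : 0 < e / 2 by lra.
have l_gt0 : 0 < l by rewrite /l !lt_min ltr01 l00 divr_gt0.
have l1 : l <= 1 by rewrite /l !ge_min lexx.
have ll0 : l <= l0 by rewrite /l !ge_min lexx orbT.
have le : l * c' <= e / 2 by rewrite -ler_pdivlMr// /l !ge_min lexx !orbT.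
have lc : l * c <= e / 2.
  apply: le_trans le; rewrite ler_pM2l// /c'.
  by apply: le_trans (ler_norm c) _; lra.
have := K l; rewrite l_gt0 ll0 => /(_ isT); rewrite ler_norml => /andP[K1 _].
have := H l; rewrite l_gt0 l1 => /(_ isT) H1.
have : l * grad f u d <= l * (B + e).
  have := ler_wpM2l (ltW l_gt0) lc; rewrite expr2 in H1; nra.
by rewrite ler_pM2l.
Qed.

Lemma grad_ge f u d (B c : R) : differentiable (f : U -> R^o) u ->
  (forall l : R, 0 < l <= 1 -> l * B - l ^+ 2 * c <= f (u + l *: d) - f u) ->
  B <= grad f u d.
Proof.
move=> df H; rewrite -lerN2.
suff -> : - grad f u d = grad (fun v => - f v) u d.
  apply: (@grad_le _ _ _ _ c) => [|l /H]; first exact: differentiableN.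
  rewrite mulrN; lra.
by rewrite /grad; have := diffN df => ->.
Qed.

Lemma cvx_first_order C f u v : cvx_on C f -> C u -> C v ->
  differentiable (f : U -> R^o) u -> f u + grad f u (v - u) <= f v.
Proof.
move=> Cf Cu Cv df; rewrite addrC -lerBrDr.
apply: (@grad_le _ _ _ _ 0) => // l /andP[l0 l1].
rewrite -segmentE mulr0 addr0.
have := Cf v u l Cv Cu; rewrite l1 (ltW l0) => /(_ isT); lra.
Qed.

(** Strong convexity along the segment from u to v bounds the increments of w
    with a second-order error, and [grad_le] applies. *)
Lemma bregman_ge C (w : U -> \bar R) u v : strongly_convex1 C (fine \o w) ->
  C u -> C v -> differentiable (fine \o w : U -> R^o) u ->
  `|v - u| ^+ 2 / 2 <= bregman w v u.
Proof.
move=> Cw Cu Cv dw; rewrite /bregman.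
suff : grad (fine \o w) u (v - u) <=
    fine (w v) - fine (w u) - `|v - u| ^+ 2 / 2 by lra.
apply: (@grad_le _ _ _ _ (`|v - u| ^+ 2 / 2)) => // l /andP[l0 l1].
rewrite -segmentE.
have := Cw v u l Cv Cu; rewrite l1 (ltW l0) => /(_ isT) /=.
by set a := fine _; set b := fine _; set c := fine _; set n := `|_| ^+ 2; lra.
Qed.

(** Continuity makes l bounded on the unit ball; for an unbounded set [sup]
    would take a default value. *)
Lemma dual_norm_le (l : {linear U -> R^o}) h : continuous l ->
  `|l h| <= dual_norm (l : U -> R) * `|h|.
Proof.
move=> cl; have [->|h0] := eqVneq h 0; first by rewrite linear0 !normr0 mulr0.
have nh : 0 < `|h| by rewrite normr_gt0.
rewrite -ler_pdivrMr//.
have -> : `|l h| / `|h| = `|l (`|h|^-1 *: h)|.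
  by rewrite linearZ /= normrM normfV normr_id mulrC.
apply: ub_le_sup; last first.
  exists (`|h|^-1 *: h) => //=.
  by rewrite normrZ normfV normr_id mulVf ?gt_eqF.
have /bounded_funP/(_ 1)[M HM] : bounded_near l (nbhs (0 : U)).
  exact/linear_bounded_continuous.
by exists M => _ [v /= v1 <-]; exact: HM.
Qed.

Lemma grad_dual_norm f g u v h (K : R) :
  differentiable (f : U -> R^o) u -> differentiable (g : U -> R^o) v ->
  dual_norm (fun h => grad f u h - grad g v h) <= K ->
  `|grad f u h - grad g v h| <= K * `|h|.
Proof.
move=> df dg; pose l := fun h => (grad f u h - grad g v h : R^o).
have ll : linear l.
  by move=> a x y; rewrite /l !gradD !gradZ -[a *: _]/(a * _); ring.
pose L : {linear U -> R^o} := HB.pack l (GRing.isLinear.Build _ _ _ _ l ll).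
have cL : continuous L.
  move=> x; apply: continuousB; exact: diff_continuous.
move=> lK; apply: le_trans (dual_norm_le h cL) _.
by rewrite ler_wpM2r.
Qed.

End Gradient.

(** * Quadratic bounds from Lipschitz gradients *)

Section Descent.
Context {R : realType} {U : normedModType R}.
Implicit Types (C : set U) (f g : U -> R) (u v d : U).

Lemma gradN f u d : differentiable (f : U -> R^o) u ->
  grad (fun v => - f v) u d = - grad f u d.
Proof. by move=> df; rewrite /grad; have := diffN df => ->. Qed.

(** Cut the segment into n + 1 equal pieces.  By convexity the increment on
    each piece is at most the slope at its endpoint, so the Lipschitz bound
    on the slopes adds up to K / 2 + K / (2 (n + 1)).  Convexity thus replaces
    the integration of the gradient and keeps the sharp factor 1 / 2. *)
Lemma descent_segment C f u v (K : R) : cvx_set C -> cvx_on C f ->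
  (forall w, C w -> differentiable (f : U -> R^o) w) -> C u -> C v ->
  (forall l : R, 0 <= l <= 1 ->
    `|grad f (u + l *: (v - u)) (v - u) - grad f u (v - u)| <= l * K) ->
  f v <= f u + grad f u (v - u) + K / 2.
Proof.
move=> CC Cf df Cu Cv lip; pose d := v - u.
have K0 : 0 <= K by have := lip 1; rewrite lexx ler01 mul1r => /(_ isT); apply: le_trans.
have step (n : nat) : f v <= f u + grad f u d + K / 2 + K / 2 / n.+1%:R.
  pose h : R := n.+1%:R^-1.
  have h0 : 0 < h by rewrite invr_gt0 ltr0n.
  have hn : n.+1%:R * h = 1 :> R by rewrite mulfV// pnatr_eq0.
  pose x (k : nat) := u + (k%:R * h) *: d.
  have kh (k : nat) : (k <= n.+1)%N -> 0 <= k%:R * h <= 1.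
    by move=> kn; rewrite mulr_ge0 ?ler0n ?(ltW h0)//= -[leRHS]hn ler_pM2r// ler_nat.
  have Cx k : (k <= n.+1)%N -> C (x k) by move=> kn; apply: cvx_segment => //; exact: kh.
  have main k : (k <= n.+1)%N ->
      f (x k) <= f u + (k%:R * h) * grad f u d + K / 2 * h ^+ 2 * (k%:R * (k%:R + 1)).
    elim: k => [|k IH] kn; first by rewrite /x mul0r scale0r addr0 !mul0r mulr0 !addr0.
    have := IH (ltnW kn).
    have := cvx_first_order Cf (Cx _ kn) (Cx _ (ltnW kn)) (df _ (Cx _ kn)).
    have -> : x k - x k.+1 = (- h) *: d.
      rewrite /x opprD addrACA subrr add0r -scalerBl; congr (_ *: _).
      by rewrite -mulrBl -[k.+1]addn1 natrD; ring.
    rewrite gradZ.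
    have := lip _ (kh _ kn); rewrite -/d -/(x k.+1) => /ler_normlP[_].
    rewrite -[in X in _ <= X]addn1 -addn1 natrD.
    move=> H1 H2 H3.
    have := ler_wpM2l (ltW h0) H1; lra.
  have := main n.+1 (leqnn _); rewrite /x hn scale1r /d addrC subrK.
  move=> H; apply: le_trans H _; rewrite mul1r.
  have -> : K / 2 * h ^+ 2 * (n.+1%:R * (n.+1%:R + 1)) =
    K / 2 * (n.+1%:R * h) * (n.+1%:R * h + h) by ring.
  by rewrite hn -/h !mulr1; lra.
apply/ler_addgt0Pr => e e0.
have [n] : exists n : nat, K / 2 / e < n.+1%:R.
  by exists (Num.truncn (K / 2 / e)); rewrite truncnS_gt.
rewrite ltr_pdivrMr// => Kn; apply: le_trans (step n) _.
by rewrite lerD2l ler_pdivrMr// [leRHS]mulrC ltW.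
Qed.

Lemma descent_lipschitz C f (L : R) u v : cvx_set C -> cvx_on C f ->
  (forall w, C w -> differentiable (f : U -> R^o) w) ->
  lipschitz_grad_on C f L -> C u -> C v ->
  f v <= f u + grad f u (v - u) + L / 2 * `|v - u| ^+ 2.
Proof.
move=> CC Cf df lip Cu Cv.
suff: f v <= f u + grad f u (v - u) + (L * `|v - u| ^+ 2) / 2 by lra.
apply: (descent_segment CC _ _ Cu Cv) => // l l01.
have Cl := cvx_segment CC Cu Cv l01.
have := grad_dual_norm (v - u) (df _ Cl) (df _ Cu) (lip _ _ Cl Cu).
rewrite addrAC subrr add0r normrZ ger0_norm; last by case/andP: l01.
by move/le_trans; apply; rewrite expr2; lra.
Qed.

(** The gradients of - f vary exactly as much as those of f, so the convex
    case applies to - f. *)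
Lemma neg_descent_lipschitz C f (L : R) u v : cvx_set C ->
  cvx_on C (fun w => - f w) ->
  (forall w, C w -> differentiable (f : U -> R^o) w) ->
  lipschitz_grad_on C f L -> C u -> C v ->
  f u + grad f u (v - u) - L / 2 * `|v - u| ^+ 2 <= f v.
Proof.
move=> CC Cf df lip Cu Cv.
have dN w : C w -> differentiable ((fun w => - f w) : U -> R^o) w.
  by move=> /df ?; exact: differentiableN.
suff: - f v <= - f u + grad (fun w => - f w) u (v - u) + (L * `|v - u| ^+ 2) / 2.
  by rewrite gradN; [lra|exact: df].
apply: (descent_segment CC _ _ Cu Cv) => // l l01.
have Cl := cvx_segment CC Cu Cv l01.
rewrite !gradN; [|exact: df|exact: df].
rewrite -opprD normrN.
have := grad_dual_norm (v - u) (df _ Cl) (df _ Cu) (lip _ _ Cl Cu).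
rewrite addrAC subrr add0r normrZ ger0_norm; last by case/andP: l01.
by move/le_trans; apply; rewrite expr2; lra.
Qed.

End Descent.

(** * Completeness of finite-dimensional normed spaces *)

Section FiniteDimension.
Context {R : realType} {U : normedModType R}.
Implicit Types (S : set U) (x : nat -> U).

Definition cauchy_in_norm x := forall e : R, 0 < e ->
  exists N, forall m n, (N <= m)%N -> (N <= n)%N -> `|x m - x n| <= e.

Definition cvg_in_norm x (l : U) := forall e : R, 0 < e ->
  exists N, forall n, (N <= n)%N -> `|x n - l| <= e.

Definition seq_complete S := forall x, (forall n, S (x n)) ->
  cauchy_in_norm x -> exists2 l, S l & cvg_in_norm x l.

Definition span_of (e : nat -> U) (k : nat) : set U :=
  [set u | exists c : nat -> R, u = \sum_(i < k) c i *: e i].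

Lemma inv_small (e : R) : 0 < e ->
  exists N : nat, forall n, (N <= n)%N -> n.+1%:R^-1 <= e.
Proof.
move=> e0; exists (Num.truncn e^-1) => n Nn.
rewrite invf_ple ?posrE ?ltr0n//; apply: le_trans (ltW (truncnS_gt _)) _.
by rewrite ler_nat.
Qed.

Lemma cvg_in_norm_unique x l l' : cvg_in_norm x l -> cvg_in_norm x l' -> l = l'.
Proof.
move=> xl xl'; apply/eqP; rewrite -subr_eq0 -normr_le0; apply/ler_addgt0Pr => e e0.
have e2 : 0 < e / 2 by lra.
have [N HN] := xl _ e2; have [N' HN'] := xl' _ e2.
have := HN _ (leq_maxl N N'); have := HN' _ (leq_maxr N N').
set y := x _ => H H'; rewrite add0r.
have -> : l - l' = (y - l') - (y - l) by rewrite opprB [RHS]addrC subrKA.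
by apply: le_trans (ler_normB _ _) _; lra.
Qed.

Lemma real_cauchy_cvg (c : nat -> R) :
  (forall e : R, 0 < e ->
    exists N, forall m n, (N <= m)%N -> (N <= n)%N -> `|c m - c n| <= e) ->
  exists l : R, forall e : R, 0 < e ->
    exists N, forall n, (N <= n)%N -> `|c n - l| <= e.
Proof.
move=> cc.
have /cauchy_cvgP cvgc : cauchy (c @ \oo).
  apply/cauchyP => e e0; have [|N HN] := cc (e / 2); first by lra.
  exists (c N); exists N => // n /= Nn; rewrite -ball_normE /=.
  by have := HN N n (leqnn _) Nn; lra.
exists (lim (c @ \oo)) => e e0.
have /cvgrPdist_le/(_ e e0)[N _ HN] := cvgc.
by exists N => n Nn; rewrite distrC; exact: HN.
Qed.

(** Induction on the number k of vectors.  If the next vector e_k is not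
    already in the span, its distance d to the span is positive, because the
    span is complete and hence closed.  Then |c| d <= |w + c e_k|, so the
    coordinates along e_k of a Cauchy sequence form a Cauchy sequence of
    reals, and subtracting this part leaves a Cauchy sequence in the span. *)
Lemma span_complete (e : nat -> U) k : seq_complete (span_of e k).
Proof.
elim: k => [x Sx _|k IH].
  exists 0; first by exists (fun=> 0); rewrite big_ord0.
  move=> d d0; exists 0%N => n _; have [c ->] := Sx n.
  by rewrite big_ord0 subrr normr0 ltW.
have spanD u v (a : R) : span_of e k u -> span_of e k v -> span_of e k (u + a *: v).
  move=> [c ->] [c' ->]; exists (fun i => c i + a * c' i).
  rewrite scaler_sumr -big_split; apply: eq_bigr => i _ /=.
  by rewrite scalerDl scalerA.
have span0 : span_of e k 0.
  by exists (fun=> 0); rewrite big1// => i _; rewrite scale0r.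
have spanS u : span_of e k.+1 u <-> exists (c : R) w, span_of e k w /\ u = w + c *: e k.
  split=> [[c ->]|[c [_ [[c' ->] ->]]]].
    exists (c k), (\sum_(i < k) c i *: e i); split; first by exists c.
    by rewrite big_ord_recr.
  exists (fun i => if (i < k)%N then c' i else c).
  rewrite big_ord_recr /= ltnn; congr (_ + _); apply: eq_bigr => i _.
  by rewrite ltn_ord.
have [ek|Nek] := pselect (span_of e k (e k)).
  have E u : span_of e k.+1 u <-> span_of e k u.
    rewrite spanS; split=> [[c [w [Sw ->]]]|Su]; first exact: spanD.
    by exists 0, u; rewrite scale0r addr0.
  move=> x Sx cx; have [l Sl xl] := IH x (fun n => (E _).1 (Sx n)) cx.
  by exists l => //; apply/E.
(* Otherwise vectors w_n of the span converge to - e_k, which then lies in the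
   span by completeness. *)
have [d d0 Hd] : exists2 d : R, 0 < d & forall w, span_of e k w -> d <= `|e k + w|.
  apply: contrapT => H.
  have /choice[w Hw] : forall n : nat, exists w, span_of e k w /\ `|e k + w| <= n.+1%:R^-1.
    move=> n; apply: contrapT => Hn; apply: H; exists n.+1%:R^-1.
      by rewrite invr_gt0.
    move=> w Sw; rewrite leNgt; apply/negP => lt; apply: Hn.
    by exists w; split => //; exact: ltW.
  have wl : cvg_in_norm w (- e k).
    move=> d d0; have [N HN] := inv_small d0; exists N => n Nn.
    by rewrite opprK addrC; apply: le_trans (Hw n).2 (HN _ Nn).
  have [||l Sl xl] := IH w; first by move=> n; exact: (Hw n).1.
    move=> d d0; have [|N HN] := wl (d / 2); first by lra.
    exists N => m n Nm Nn; have := HN _ Nm; have := HN _ Nn.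
    move=> Hn Hm; apply: le_trans (ler_distD (- e k) _ _) _.
    by rewrite (distrC _ (w n)); lra.
  by apply: Nek; rewrite -[e k]opprK -(cvg_in_norm_unique xl wl)
     -[- l]add0r -scaleN1r; exact: spanD.
move=> x Sx cx.
have /choice[cw Hcw] : forall n, exists cw : R * U,
    span_of e k cw.2 /\ x n = cw.2 + cw.1 *: e k.
  by move=> n; have /spanS[c [w H]] := Sx n; exists (c, w).
have dist (c : R) w : span_of e k w -> `|c| * d <= `|w + c *: e k|.
  move=> Sw; have [->|c0] := eqVneq c 0; first by rewrite normr0 mul0r.
  have -> : w + c *: e k = c *: (e k + (0 + c^-1 *: w)).
    by rewrite add0r scalerDr scalerA mulfV// scale1r addrC.
  by rewrite normrZ ler_pM2l ?normr_gt0//; apply: Hd; exact: spanD.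
have diffx m n : x m - x n = ((cw m).2 + (-1) *: (cw n).2) + ((cw m).1 - (cw n).1) *: e k.
  rewrite (Hcw m).2 (Hcw n).2 opprD addrACA scaleN1r; congr (_ + _).
  by rewrite scalerBl.
have [c Hc] : exists c : R, forall r : R, 0 < r ->
    exists N, forall n, (N <= n)%N -> `|(cw n).1 - c| <= r.
  apply: real_cauchy_cvg => r r0; have [|N HN] := cx (r * d); first exact: mulr_gt0.
  exists N => m n Nm Nn; rewrite -(ler_pM2r d0); apply: le_trans (HN m n Nm Nn).
  by rewrite diffx; apply: dist; apply: spanD; [exact: (Hcw m).1|exact: (Hcw n).1].
have ck : cvg_in_norm (fun n => (cw n).1 *: e k) (c *: e k).
  move=> r r0; have K0 : 0 < `|e k| + 1 by rewrite ltr_wpDl.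
  have [|N HN] := Hc (r / (`|e k| + 1)); first exact: divr_gt0.
  exists N => n Nn; rewrite -scalerBl normrZ.
  have := HN n Nn; rewrite ler_pdivlMr//; apply: le_trans.
  by rewrite ler_wpM2l// lerDl.
have [||l Sl wl] := IH (fun n => (cw n).2); first by move=> n; exact: (Hcw n).1.
  move=> r r0; have r3 : 0 < r / 3 by lra.
  have [N HN] := cx _ r3; have [N' HN'] := ck _ r3.
  exists (maxn N N') => m n; rewrite !geq_max => /andP[m1 m2] /andP[n1 n2].
  have -> : (cw m).2 - (cw n).2 = (x m - x n)
     - ((cw m).1 *: e k - c *: e k) + ((cw n).1 *: e k - c *: e k).
    rewrite diffx scaleN1r scalerBl -addrA -addrA -[LHS]addr0; congr (_ + _).
    by rewrite opprB addrA [_ + (c *: _ - _)]addrC subrKA subrKA subrr.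
  have := HN m n m1 n1; have := HN' m m2; have := HN' n n2 => ? ? ?.
  apply: le_trans (ler_normD _ _) _; apply: le_trans (lerD (ler_normB _ _) (lexx _)) _.
  lra.
exists (l + c *: e k); first by apply/spanS; exists c, l.
move=> r r0; have r2 : 0 < r / 2 by lra.
have [N HN] := wl _ r2; have [N' HN'] := ck _ r2.
exists (maxn N N') => n; rewrite !geq_max => /andP[n1 n2].
rewrite (Hcw n).2 opprD addrACA; apply: le_trans (ler_normD _ _) _.
have := HN n n1; have := HN' n n2; lra.
Qed.

Lemma finite_dimensional_complete : finite_dimensional U -> seq_complete (@setT U).
Proof.
move=> [n [e He]] x _ cx.
pose e' (i : nat) := if insub i is Some j then e j else 0.
suff Sx k : span_of e' n (x k) by have [l _ xl] := span_complete Sx cx; exists l.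
have [c ->] := He (x k).
exists (fun i => if insub i is Some j then c j else 0).
by apply: eq_bigr => i _; rewrite /e' valK.
Qed.

End FiniteDimension.

Section LinearForms.
Context {R : realType} {U : normedModType R}.
Implicit Types l : U -> R.

(** Accumulated gradients are plain functions in the algorithm; their
    linearity is what makes each subproblem a proximal problem. *)
Definition linear_form l := linear (l : U -> R^o).

Lemma linear_formP l : linear_form l <-> forall (a : R) u v, l (a *: u + v) = a * l u + l v.
Proof. by []. Qed.

Lemma linear_formB l u v : linear_form l -> l (u - v) = l u - l v.
Proof.
by move=> /linear_formP H; rewrite addrC -scaleN1r H mulN1r addrC.
Qed.

Lemma linear_form_comb l u v (t : R) : linear_form l ->
  l (t *: u + (1 - t) *: v) = t * l u + (1 - t) * l v.
Proof.
move=> /linear_formP H; rewrite H; congr (_ + _).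
rewrite -[(1 - t) *: v]addr0 H -[X in _ = X]addr0; congr (_ + _).
have := H 1 0 0; rewrite scale1r addr0 mul1r; lra.
Qed.

Lemma linear_formD l l' : linear_form l -> linear_form l' ->
  linear_form (fun v => l v + l' v).
Proof.
move=> /linear_formP H /linear_formP H'; apply/linear_formP => a u v.
by rewrite H H'; ring.
Qed.

Lemma linear_formZ l (c : R) : linear_form l -> linear_form (fun v => c * l v).
Proof. by move=> /linear_formP H; apply/linear_formP => a u v; rewrite H; ring. Qed.

Lemma linear_form_grad (f : U -> R) u : linear_form (grad f u).
Proof. by apply/linear_formP => a v v'; rewrite gradD gradZ. Qed.

Lemma cvx_on_linear_form (C : set U) l : linear_form l -> cvx_on C l.
Proof. by move=> Hl u v t _ _ _; rewrite linear_form_comb. Qed.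

End LinearForms.

(** * Proximal subproblems *)

Section ProximalProblem.
Context {R : realType} {U : normedModType R}.
Variables (C : set U) (zeta : U -> R) (w : U -> \bar R).
Hypotheses (CC : cvx_set C) (Cz : cvx_on C zeta) (dgf : is_dgf C w)
  (ps : prox_solvable C zeta w).

Lemma dgf_differentiable u : interior (dom w) u ->
  differentiable (fine \o w : U -> R^o) u.
Proof. by case: dgf => _ _ _ _ [_ H _] /H[]. Qed.

Lemma dgf_strongly_convex : strongly_convex1 C (fine \o w).
Proof. by case: dgf. Qed.

Lemma bregman_ge_sqr u v : dgf_interior C w u -> C v ->
  `|v - u| ^+ 2 / 2 <= bregman w v u.
Proof.
move=> [Cu du] Cv; apply: bregman_ge Cu Cv _; first exact: dgf_strongly_convex.
exact: dgf_differentiable.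
Qed.

(** Compare u with the points u + l (v - u).  Convexity of Q and minimality of
    u bound the increments of w from below by l (Q u - Q v) / b, hence also
    the derivative of w; adding up gives the Bregman term.  Only w has to be
    differentiable. *)
Lemma argmin_growth (Q f : U -> R) (b : R) u : 0 < b -> cvx_on C Q ->
  (forall v, f v = Q v + b * fine (w v)) -> is_argmin C f u ->
  dgf_interior C w u -> forall v, C v -> f u + b * bregman w v u <= f v.
Proof.
move=> b0 CQ fE [Cu umin] [_ du] v Cv; rewrite !fE /bregman.
suff: (Q u - Q v) / b <= grad (fine \o w) u (v - u).
  rewrite ler_pdivrMr//; lra.
apply: (@grad_ge _ _ _ _ _ _ 0); first exact: dgf_differentiable.
move=> l /andP[l0 l1]; rewrite mulr0 subr0 -segmentE.
have l01 : 0 <= l <= 1 by rewrite l1 ltW.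
have := umin _ (CC Cv Cu l01); rewrite !fE => H1.
have H2 := CQ _ _ _ Cv Cu l01.
rewrite mulrA ler_pdivrMr//=.
by move: H1 H2; set x := fine _; set y := fine _; lra.
Qed.

(** Division by a gives a proximal problem of the form assumed to have a
    unique solution in the interior of the domain of w.  By uniqueness every
    minimiser lies there, so [argmin_growth] applies to it. *)
Lemma prox_problem (l f : U -> R) (a b k : R) : linear_form l -> 0 < a -> 0 < b ->
  (forall v, f v = l v + a * zeta v + b * fine (w v) + k) ->
  (exists u, is_argmin C f u) /\
  forall u, is_argmin C f u -> dgf_interior C w u /\
    forall v, C v -> f u + b * bregman w v u <= f v.
Proof.
move=> Hl a0 b0 fE.
pose xi0 : U -> R^o := fun v => a^-1 * l v.
have Hxi : linear xi0 := linear_formZ a^-1 Hl.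
pose xi : {linear U -> R^o} := HB.pack xi0 (GRing.isLinear.Build _ _ _ _ xi0 Hxi).
have ab0 : 0 < a / b by exact: divr_gt0.
have [u0 [u0min u0int u0uniq]] := ps xi ab0.
have fE' v : f v = a * (zeta v + xi v + (a / b)^-1 * fine (w v)) + k.
  rewrite fE /xi /= /xi0 invf_div !mulrDr !mulrA divff ?gt_eqF// mul1r.
  by rewrite [a * b]mulrC mulfK ?gt_eqF//; ring.
have minE u : is_argmin C f u <->
    is_argmin C (fun v => zeta v + xi v + (a / b)^-1 * fine (w v)) u.
  split=> -[Cu umin]; split => // v /umin; rewrite ?fE' lerD2r ler_pM2l//.
split; first by exists u0; apply/minE.
move=> u umin; have uu0 : u = u0 by apply: u0uniq; apply/minE.
have uint : dgf_interior C w u by rewrite uu0.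
split=> //; apply: (argmin_growth (Q := fun v => l v + a * zeta v + k)) => //.
  move=> x y t Cx Cy t01; have := ler_wpM2l (ltW a0) (Cz Cx Cy t01).
  by rewrite (linear_form_comb _ _ _ Hl); lra.
by move=> v; rewrite fE; ring.
Qed.

(** All three subproblems of the accelerated method have this shape.  The
    Bregman distance to p differs from w by an affine function, so only the
    weights change. *)
Lemma prox_problem_bregman (l f : U -> R) (a m c k : R) (p : U) :
  linear_form l -> 0 < a -> 0 < m -> 0 < c ->
  (forall v, f v = l v + a * (zeta v + m * fine (w v)) + c * bregman w v p + k) ->
  (exists u, is_argmin C f u) /\
  forall u, is_argmin C f u -> dgf_interior C w u /\
    forall v, C v -> f u + (a * m + c) * bregman w v u <= f v.
Proof.
move=> Hl a0 m0 c0 fE.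
apply: (@prox_problem (fun v => l v + (- c) * grad (fine \o w) p v) f a (a * m + c)
  (c * grad (fine \o w) p p - c * fine (w p) + k)) => //.
- by apply: linear_formD => //; apply: linear_formZ; exact: linear_form_grad.
- by rewrite addr_gt0// mulr_gt0.
- by move=> v; rewrite fE /bregman gradB; ring.
Qed.

End ProximalProblem.

(** * The accelerated method with an inexact oracle *)

Local Arguments apg_alpha : simpl never.

Section AcceleratedProximalGradient.
Context {R : realType} {U : normedModType R}.
Variables (C : set U) (zeta : U -> R) (w : U -> \bar R).
Hypotheses (CC : cvx_set C) (Cz : cvx_on C zeta) (dgf : is_dgf C w)
  (ps : prox_solvable C zeta w).
Variables (m L : R) (u0 : U).
Hypotheses (m0 : 0 < m) (L0 : 0 < L) (u0int : dgf_interior C w u0).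

Let theta := m / L.
Let theta0 : 0 < theta. Proof. exact: divr_gt0. Qed.

Lemma apg_A_expr (th : R) t : apg_A th t = (1 + Num.sqrt th) ^+ t.
Proof.
elim: t => [|t IH]; first by rewrite /apg_A big_ord_recr big_ord0 /= add0r expr0.
rewrite /apg_A big_ord_recr /= -/(apg_A th t) IH exprS.
by rewrite -[apg_alpha th _]/((1 + Num.sqrt th) ^+ t * Num.sqrt th); ring.
Qed.

Lemma apg_A_gt0 (th : R) t : 0 < apg_A th t.
Proof. by rewrite apg_A_expr exprn_gt0// ltr_wpDr ?sqrtr_ge0. Qed.

Lemma apg_alphaS (th : R) t : apg_alpha th t.+1 = apg_A th t * Num.sqrt th.
Proof. by rewrite apg_A_expr. Qed.

Lemma apg_AS (th : R) t : apg_A th t.+1 = apg_A th t + apg_alpha th t.+1.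
Proof. by rewrite /apg_A big_ord_recr. Qed.

Lemma apg_alpha_ge0 (th : R) t : 0 <= apg_alpha th t.
Proof. by case: t => [|t]//; rewrite apg_alphaS mulr_ge0 ?sqrtr_ge0// ltW ?apg_A_gt0. Qed.

Lemma apg_tau01 (th : R) t : 0 <= apg_tau th t.+1 <= 1.
Proof.
rewrite /apg_tau divr_ge0 ?apg_alpha_ge0//= ?(ltW (apg_A_gt0 _ _))//.
by rewrite ler_pdivrMr ?apg_A_gt0// mul1r apg_AS lerDr ltW ?apg_A_gt0.
Qed.

Lemma apg_alphaS_gt0 t : 0 < apg_alpha theta t.+1.
Proof. by rewrite apg_alphaS mulr_gt0 ?apg_A_gt0// sqrtr_gt0. Qed.

Lemma apg_s_linear (th : R) (G : nat -> U -> R) t :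
  (forall i, linear_form (G i)) -> linear_form (apg_s th G t).
Proof.
move=> HG; elim: t => [|t IH] //=.
by apply: linear_formD => //; exact: linear_formZ.
Qed.

Section Run.
Variables (G : nat -> U -> R) (a : apg_iterates U).
Hypotheses (HG : forall t, linear_form (G t)) (Ha : is_apg C zeta w m L u0 G a).

Let al := apg_alpha theta.
Let A := apg_A theta.
Let tau := apg_tau theta.
Let s := apg_s theta G.

Lemma apg_ubar_spec t : dgf_interior C w (apg_ubar a t.+1) /\
  forall v, C v ->
    s t (apg_ubar a t.+1) + A t * (zeta (apg_ubar a t.+1) + m * fine (w (apg_ubar a t.+1)))
      + L * bregman w (apg_ubar a t.+1) u0
      + (A t * m + L) * bregman w v (apg_ubar a t.+1)
    <= s t v + A t * (zeta v + m * fine (w v)) + L * bregman w v u0.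
Proof.
case: Ha => _ _ /(_ t)[Hu _ _ _].
have := prox_problem_bregman CC Cz dgf ps (p := u0) (k := 0) (apg_s_linear theta t HG)
  (apg_A_gt0 theta t) m0 L0 (fun v => esym (addr0 _)).
by move=> [_ /(_ _ Hu)].
Qed.

Lemma apg_feasible t : [/\ C (apg_u a t), C (apg_z a t) & C (apg_w a t.+1)].
Proof.
have Cw k : C (apg_w a k.+1) by case: Ha => _ _ /(_ k)[_ _ []].
elim: t => [|t [Cu Cz' Cw']].
  by case: Ha => -> [Cz' _] _; split => //; case: u0int.
case: (Ha) => _ _ /(_ t)[_ -> _ ->].
have [[Cub _] _] := apg_ubar_spec t.
have comb x y : C x -> C y -> C ((1 - tau t.+1) *: x + tau t.+1 *: y).
  by move=> Cx Cy; rewrite addrC; apply: CC => //; exact: apg_tau01.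
by split => //; exact: comb.
Qed.

Variables (h : U -> R) (H : nat -> R) (eps : R).
Let ell t v := H t + G t (v - apg_u a t).
Let F v := h v + zeta v + m * fine (w v).
(* The affine models [ell t] form an inexact first-order oracle for h with
   constant L and error eps. *)
Hypotheses (lower : forall t v, C v -> ell t v <= h v)
  (upper : forall t v, C v ->
     h v <= ell t v + L / 2 * `|v - apg_u a t| ^+ 2 + eps).

(* The model minimised by [apg_ubar a t.+1]; it differs from the objective of
   that subproblem by a constant. *)
Let S t v := \sum_(i < t.+1) al i * ell i v + A t * (zeta v + m * fine (w v))
   + L * bregman w v u0.

Let sumS (f : nat -> R) t : \sum_(i < t.+1) f i = \sum_(i < t) f i + f t.
Proof. exact: big_ord_recr. Qed.

Let model_sum t : exists k, forall v, \sum_(i < t.+1) al i * ell i v = s t v + k.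
Proof.
elim: t => [|t [k IH]].
  exists (H 0%N - G 0%N (apg_u a 0%N)) => v.
  rewrite big_ord_recr big_ord0 /= add0r mul1r /ell linear_formB//.
  by have -> : s 0%N v = G 0%N v by []; lra.
exists (k + al t.+1 * (H t.+1 - G t.+1 (apg_u a t.+1))) => v.
rewrite (sumS (fun i => al i * ell i v)) IH /ell linear_formB//.
by have -> : s t.+1 v = s t v + al t.+1 * G t.+1 v by []; ring.
Qed.

Let w_cvx : cvx_on C (fine \o w).
Proof. exact: strongly_convex_cvx (dgf_strongly_convex dgf). Qed.

Let F_comb_le t x y : C x -> C y ->
  let z := (1 - tau t.+1) *: x + tau t.+1 *: y in
  A t.+1 * (zeta z + m * fine (w z)) <=
  A t * (zeta x + m * fine (w x)) + al t.+1 * (zeta y + m * fine (w y)).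
Proof.
move=> Cx Cy /=; rewrite [(1 - tau t.+1) *: x + _]addrC.
have H1 := Cz Cy Cx (apg_tau01 theta t).
have := ler_wpM2l (ltW m0) (w_cvx Cy Cx (apg_tau01 theta t)) => /= H2.
have A0 := apg_A_gt0 theta t.+1.
have := ler_wpM2l (ltW A0) (lerD H1 H2).
have At : A t.+1 * tau t.+1 = al t.+1 by rewrite mulrC divfK// gt_eqF.
have AS : A t.+1 * (1 - tau t.+1) = A t.
  by rewrite mulrBr mulr1 At /A apg_AS addrK.
rewrite -/(A _) => H3; apply: le_trans H3 _.
rewrite -At -AS -/(tau _) le_eqVlt; apply/orP; left; apply/eqP; ring.
Qed.

(* This is where the weights matter: alpha_(t+1)^2 = theta A_t^2, so the
   quadratic error at z_(t+1), scaled by tau^2, is paid for by the strong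
   convexity constant A_t m + L of the model. *)
Let stepsize t : L * A t.+1 * tau t.+1 ^+ 2 <= A t * m + L.
Proof.
have A0 := apg_A_gt0 theta t; have A1 := apg_A_gt0 theta t.+1.
rewrite /tau /apg_tau expr_div_n -/(A _).
have -> : L * A t.+1 * (al t.+1 ^+ 2 / A t.+1 ^+ 2) = L * al t.+1 ^+ 2 / A t.+1.
  by field; rewrite gt_eqF.
rewrite ler_pdivrMr// /al apg_alphaS exprMn sqr_sqrtr ?ltW//.
have -> : L * (apg_A theta t ^+ 2 * theta) = (A t) ^+ 2 * m.
  by rewrite /theta /A; field; rewrite gt_eqF.
have AA : A t <= A t.+1 by rewrite /A apg_AS lerDl apg_alpha_ge0.
have mA := mulr_gt0 A0 m0; rewrite -/(A t) in A0 mA.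
have := ler_wpM2l (ltW mA) AA; have := mulr_gt0 L0 A1; rewrite -/(A _) expr2; lra.
Qed.

(** Induction on t.  The induction hypothesis at the minimiser of the model and
    the growth of the model around it turn S_(t+1)(v) into a bound by
    A_t F(z_t) plus the objective of the subproblem for w_(t+1).  The lower
    model at z_t and convexity combine z_t and w_(t+1) into z_(t+1), and since
    z_(t+1) - u_(t+1) = tau (w_(t+1) - ubar_(t+1)), the Bregman term dominates
    the quadratic term of the upper model. *)
Theorem apg_estimate t v : C v ->
  A t * F (apg_z a t) <= S t v + eps * \sum_(i < t.+1) A i.
Proof.
elim: t v => [|t IH] v Cv.
  rewrite big_ord_recr big_ord0 /= add0r.
  case: (Ha) => u0E [Cz0 z0min] _.
  have [k Hk] := model_sum 0.
  have := z0min v Cv; have := Hk v; have := Hk (apg_z a 0).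
  have := upper 0 Cz0; have := bregman_ge_sqr dgf u0int Cz0.
  rewrite /S /F u0E !big_ord_recr !big_ord0 /= !add0r.
  have -> : A 0 = 1 by rewrite /A apg_A_expr expr0.
  rewrite /al /= !mul1r.
  move=> /(ler_wpM2l (ltW L0)).
  have s0 x : s 0%N x = G 0%N x by [].
  by rewrite !s0; lra.
have [_ Cz1 Cw] := apg_feasible t.
have [_ Cz2 _] := apg_feasible t.+1.
have [ubint ubgrow] := apg_ubar_spec t.
have Cub := ubint.1.
case: (Ha) => _ _ /(_ t)[_ uE [_ wmin] zE].
have := IH _ Cub; have := ubgrow v Cv; have := wmin v Cv.
have [k Hk] := model_sum t.
have := Hk v; have := Hk (apg_ubar a t.+1).
have := lower t.+1 Cz1; have := upper t.+1 Cz2.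
have := bregman_ge_sqr dgf ubint Cw.
have := @F_comb_le t _ _ Cz1 Cw; rewrite -zE /=.
have zu : apg_z a t.+1 - apg_u a t.+1 = tau t.+1 *: (apg_w a t.+1 - apg_ubar a t.+1).
  by rewrite zE uE opprD addrACA subrr add0r scalerBr.
have GB i x y : G i (x - y) = G i x - G i y by exact: linear_formB.
have ellz : A t.+1 * ell t.+1 (apg_z a t.+1) =
    A t * ell t.+1 (apg_z a t) + al t.+1 * ell t.+1 (apg_w a t.+1).
  have At : A t.+1 * tau t.+1 = al t.+1.
    by rewrite mulrC divfK// gt_eqF ?apg_A_gt0.
  have AS : A t.+1 * (1 - tau t.+1) = A t.
    by rewrite mulrBr mulr1 At /A apg_AS addrK.
  have Gz : G t.+1 (apg_z a t.+1) =
      (1 - tau t.+1) * G t.+1 (apg_z a t) + tau t.+1 * G t.+1 (apg_w a t.+1).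
    by rewrite zE [(1 - _) *: _ + _]addrC (linear_form_comb _ _ _ (HG t.+1)) addrC.
  by rewrite -At -AS /ell !GB Gz; ring.
have gw : ell t.+1 (apg_w a t.+1) - ell t.+1 v = G t.+1 (apg_w a t.+1) - G t.+1 v.
  by rewrite /ell !GB; ring.
have step := stepsize t.
rewrite zu normrZ exprMn (ger0_norm (andP (apg_tau01 theta t)).1).
rewrite /S /F [\sum_(i < t.+2) al i * _]big_ord_recr /=.
rewrite [\sum_(i < t.+2) A i]big_ord_recr /=.
rewrite -/theta -/(tau _) -/(al _) -/(A _) -/(A t) -/(s t).
set n := `|_| ^+ 2; have n0 : 0 <= n by exact: sqr_ge0.
have A1 : 0 < A t.+1 := apg_A_gt0 theta t.+1.
have A0 : 0 < A t := apg_A_gt0 theta t.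
have AS : A t.+1 = A t + al t.+1 by rewrite /A apg_AS.
have Am : 0 < A t * m + L by rewrite addr_gt0// mulr_gt0.
move=> c1 /(ler_wpM2l (ltW Am)) c2 /(ler_wpM2l (ltW A1)) c3.
move=> /(ler_wpM2l (ltW A0)) c4 c5 c6 c7 c8 c9.
have := ler_wpM2r n0 step.
have {}gw : al t.+1 * ell t.+1 (apg_w a t.+1) - al t.+1 * ell t.+1 v
  = al t.+1 * G t.+1 (apg_w a t.+1) - al t.+1 * G t.+1 v by rewrite -!mulrBr gw.
move: c1 c2 c3 c4 c5 c6 c7 c8 c9 ellz gw.
rewrite AS.
move: (\sum_(i < t.+1) al i * ell i v) (\sum_(i < t.+1) al i * ell i (apg_ubar a t.+1))
  (\sum_(i < t.+1) A i) => s1 s2 s3.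
lra.
Qed.

End Run.
End AcceleratedProximalGradient.

(** * Existence of runs and accumulation of errors *)

Section ApgRates.
Context {R : realType} {U : normedModType R}.
Variables (C : set U) (zeta : U -> R) (w : U -> \bar R).
Hypotheses (CC : cvx_set C) (Cz : cvx_on C zeta) (dgf : is_dgf C w)
  (ps : prox_solvable C zeta w).
Variables (m L : R) (u0 : U).
Hypotheses (m0 : 0 < m) (L0 : 0 < L) (u0int : dgf_interior C w u0).

(** A geometric sum: errors entering with the weights A_i are amplified at
    most by 1 + 1 / sqrt q on average. *)
Lemma apg_A_sum (q : R) t : 0 < Num.sqrt q ->
  \sum_(i < t.+1) apg_A q i <= apg_A q t * (1 + (Num.sqrt q)^-1).
Proof.
move=> q0; elim: t => [|t IH].
  rewrite big_ord_recr big_ord0 /= add0r apg_A_expr expr0 mul1r.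
  by rewrite lerDl invr_ge0 ltW.
rewrite big_ord_recr /=; apply: le_trans (lerD IH (lexx _)) _.
rewrite !apg_A_expr exprS le_eqVlt; apply/orP; left; apply/eqP; field.
by rewrite gt_eqF.
Qed.

Record apg_state := ApgState {
  state_u : U; state_ubar : U; state_w : U; state_z : U; state_s : U -> R }.

(** Every subproblem has a solution, so a run is built by recursion on a state
    that carries the accumulated gradient.  The gradient field [Gam] gives
    gradients as a function of the query point, which is the only information
    from the run that both levels of the method use. *)
Lemma apg_exists (Gam : U -> U -> R) : (forall u, linear_form (Gam u)) ->
  exists a, is_apg C zeta w m L u0 (fun t => Gam (apg_u a t)) a.
Proof.
move=> HG.
pose theta := m / L.
pose am (f : U -> R) := xget u0 (is_argmin C f).
pose st0 := ApgState u0 u0 u0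
  (am (fun v => Gam u0 v + zeta v + m * fine (w v) + L * bregman w v u0)) (Gam u0).
pose next t st :=
  let A := apg_A theta t in
  let al := apg_alpha theta t.+1 in
  let tau := apg_tau theta t.+1 in
  let ub := am (fun v => state_s st v + A * (zeta v + m * fine (w v))
                         + L * bregman w v u0) in
  let u := (1 - tau) *: state_z st + tau *: ub in
  let wn := am (fun v => al * (Gam u v + zeta v + m * fine (w v))
                         + (A * m + L) * bregman w v ub) in
  ApgState u ub wn ((1 - tau) *: state_z st + tau *: wn)
    (fun v => state_s st v + al * Gam u v).
pose st := fix st t := if t is t'.+1 then next t' (st t') else st0.
pose a := ApgIterates (fun t => state_u (st t)) (fun t => state_ubar (st t))
  (fun t => state_w (st t)) (fun t => state_z (st t)).
have sE t : apg_s theta (fun i => Gam (apg_u a i)) t = state_s (st t).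
  by elim: t => //= t ->.
have amP f : (exists u, is_argmin C f u) -> is_argmin C f (am f).
  by move=> ex; rewrite /am; exact: (xgetPex _ ex).
exists a; split => //.
  apply: amP.
  have [] // := @prox_problem_bregman _ _ C zeta w CC Cz dgf ps (Gam u0)
    (fun v => Gam u0 v + zeta v + m * fine (w v) + L * bregman w v u0)
    1 m L 0 u0 (HG _) ltr01 m0 L0.
  by move=> v; ring.
move=> t; split => //.
  rewrite sE; apply: amP.
  have [] // := @prox_problem_bregman _ _ C zeta w CC Cz dgf ps (state_s (st t))
    (fun v => state_s (st t) v + apg_A theta t * (zeta v + m * fine (w v))
                         + L * bregman w v u0)
    (apg_A theta t) m L 0 u0 _ (apg_A_gt0 _ _) m0 L0.
    by rewrite -sE; exact: apg_s_linear.
  by move=> v; ring.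
apply: amP.
have [] // := @prox_problem_bregman _ _ C zeta w CC Cz dgf ps
  (fun v => apg_alpha theta t.+1 * Gam (apg_u a t.+1) v)
  (fun v => apg_alpha theta t.+1 * (Gam (apg_u a t.+1) v + zeta v + m * fine (w v))
     + (apg_A theta t * m + L) * bregman w v (apg_ubar a t.+1))
  (apg_alpha theta t.+1) m (apg_A theta t * m + L) 0 (apg_ubar a t.+1)
  (linear_formZ _ (HG _)) (apg_alphaS_gt0 m0 L0 t) m0.
- by rewrite addr_gt0// mulr_gt0// apg_A_gt0.
- by move=> v; ring.
Qed.

(** The case eps = 0 of [apg_estimate], with the models bounded by h. *)
Lemma apg_rate (G : nat -> U -> R) (a : apg_iterates U) (h : U -> R) (H : nat -> R) :
  (forall t, linear_form (G t)) -> is_apg C zeta w m L u0 G a ->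
  (forall t v, C v -> H t + G t (v - apg_u a t) <= h v) ->
  (forall t v, C v -> h v <=
     H t + G t (v - apg_u a t) + L / 2 * `|v - apg_u a t| ^+ 2) ->
  forall t v, C v ->
  h (apg_z a t) + zeta (apg_z a t) + m * fine (w (apg_z a t))
  <= h v + zeta v + m * fine (w v) + L * bregman w v u0 / apg_A (m / L) t.
Proof.
move=> HG Ha lower upper t v Cv.
have upper0 i x : C x -> h x <= H i + G i (x - apg_u a i)
     + L / 2 * `|x - apg_u a i| ^+ 2 + 0 by rewrite addr0; exact: upper.
have A0 : 0 < apg_A (m / L) t := apg_A_gt0 _ _.
rewrite -(ler_pM2l A0).
have := apg_estimate CC Cz dgf ps m0 L0 u0int HG Ha lower upper0 t Cv.
rewrite mul0r addr0 => /le_trans; apply.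
rewrite [leRHS]mulrDr [X in _ <= _ + X]mulrC divfK ?gt_eqF// lerD2r.
rewrite -addrA [leRHS]mulrDr lerD2r /apg_A mulr_suml.
by apply: ler_sum => i _; rewrite ler_wpM2l ?apg_alpha_ge0// lower.
Qed.

End ApgRates.

(** * Minimisers of strongly convex functions *)

Section StronglyConvexMinimum.
Context {R : realType} {U : normedModType R}.
Implicit Types (C : set U) (x : nat -> U).

Lemma cvg_in_norm_nbhs x l (V : set U) : cvg_in_norm x l -> nbhs l V ->
  exists N, forall n, (N <= n)%N -> V (x n).
Proof.
move=> xl /nbhs_normP[e /= e0 eV]; have [|N HN] := xl (e / 2); first by lra.
by exists N => n Nn; apply: eV; rewrite /= distrC; have := HN n Nn; lra.
Qed.

(** The midpoint inequality shows that points with values near the infimum are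
    near each other, so a minimising sequence is Cauchy; its limit lies in C
    and lower semicontinuity makes it a minimiser. *)
Lemma strongly_convex_argmin C (phi : U -> R) (c B : R) :
  finite_dimensional U -> closed C -> cvx_set C -> C !=set0 -> 0 < c ->
  (forall u v, C u -> C v ->
    phi (2^-1 *: u + (1 - 2^-1) *: v) <= (phi u + phi v) / 2 - c * `|u - v| ^+ 2) ->
  (forall v, C v -> B <= phi v) ->
  (forall l (e : R), C l -> 0 < e -> nbhs l [set v | C v -> phi l - e < phi v]) ->
  exists u, is_argmin C phi u.
Proof.
move=> fdU clC CC [u0 Cu0] c0 sc lbB lsc.
pose E := [set phi v | v in C].
have E0 : E !=set0 by exists (phi u0), u0.
have lbE : has_lbound E by exists B => _ [v Cv <-]; exact: lbB.
pose i := inf E.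
have iE v : C v -> i <= phi v by move=> Cv; apply: ge_inf => //; exists v.
have infE (d : R) : 0 < d -> exists2 v, C v & phi v <= i + d.
  move=> d0; have [_ [v Cv <-] ?] := inf_adherent d0 (conj E0 lbE).
  by exists v => //; exact: ltW.
move: (i) iE infE => {E0 lbE} {}i iE infE.
have /choice[x Hx] : forall n : nat, exists v, C v /\ phi v <= i + n.+1%:R^-1.
  move=> n; have n0 : 0 < n.+1%:R^-1 :> R by rewrite invr_gt0.
  by have [v Cv ?] := infE _ n0; exists v.
have cx : cauchy_in_norm x.
  move=> e e0; have ce : 0 < c * e ^+ 2 by rewrite mulr_gt0 ?exprn_gt0.
  have [N HN] := inv_small ce; exists N => m n Nm Nn.
  rewrite -(ler_pXn2r (n := 2))// ?nnegrE ?(ltW e0)// -(ler_pM2l c0).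
  have [Cm Hm] := Hx m; have [Cn Hn] := Hx n.
  have h01 : 0 <= (2^-1 : R) <= 1 by apply/andP; split; lra.
  have := iE _ (CC _ _ _ Cm Cn h01); have := sc _ _ Cm Cn.
  move: (HN m Nm) (HN n Nn) Hm Hn; move: (m.+1%:R^-1) (n.+1%:R^-1) => *; lra.
have [l _ xl] := finite_dimensional_complete fdU (fun=> Logic.I) cx.
have Cl : C l.
  apply: clC => V Vl; have [N HN] := cvg_in_norm_nbhs xl Vl.
  by exists (x N); split; [exact: (Hx N).1|exact: HN].
exists l; split => // v Cv; apply: le_trans (iE v Cv).
apply/ler_addgt0Pr => e e0.
have e2 : 0 < e / 2 by lra.
have [N HN] := cvg_in_norm_nbhs xl (lsc l _ Cl e2).
have [N' HN'] := inv_small e2.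
have /= := HN _ (leq_maxl N N') (Hx _).1; have := HN' _ (leq_maxr N N').
have := (Hx (maxn N N')).2; move: (_.+1%:R^-1) => *; lra.
Qed.

Lemma inf_argmin C (f : U -> R) u : is_argmin C f u -> inf [set f v | v in C] = f u.
Proof.
move=> [Cu umin]; apply/le_anti/andP; split.
  by apply: ge_inf; [exists (f u) => _ [v /umin ? <-]|exists u].
by apply: lb_le_inf; [exists (f u), u|move=> _ [v /umin ? <-]].
Qed.

End StronglyConvexMinimum.

(** * The saddle-point problem and the inexact oracle for its dual *)

Section Saddle.
Context {R : realType} {X Y : normedModType R} (P : saddle_problem X Y).
Hypothesis HP : saddle_assumptions P.
Implicit Types (x : X) (y : Y).

Lemma Xset_cvx : cvx_set (Xset P).
Proof. exact: convex_set_cvx (Xset_convex HP). Qed.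

Lemma Yset_cvx : cvx_set (Yset P).
Proof. exact: convex_set_cvx (Yset_convex HP). Qed.

Let CX := Xset_cvx.
Let CY := Yset_cvx.

Lemma rfun_fin_num x : Xset P x -> (rfun P x \is a fin_num)%E.
Proof.
rewrite -(r_dom HP) /dom/= fin_numE (r_avoids HP) /= => h.
by rewrite lt_eqF.
Qed.

Lemma rfun_cvx : cvx_on (Xset P) (fine \o rfun P).
Proof.
move=> u v t Cu Cv t01.
have := r_convex HP u v t01.
rewrite -(fineK (rfun_fin_num Cu)) -(fineK (rfun_fin_num Cv)).
by rewrite -(fineK (rfun_fin_num (CX Cu Cv t01))) /= -!EFinM -EFinD lee_fin.
Qed.

Lemma gfun_cvx : cvx_on (Yset P) (gfun P).
Proof. exact: convex_function_cvx (g_convex HP). Qed.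

Lemma Psi_cvx y : Yset P y -> cvx_on (Xset P) (Psi P ^~ y).
Proof. by move=> Cy; exact: convex_function_cvx (Psi_convex HP Cy). Qed.

Lemma Psi_ccv x : Xset P x -> cvx_on (Yset P) (fun y => - Psi P x y).
Proof. by move=> Cx; exact: convex_function_cvx (Psi_concave HP Cx). Qed.

Lemma Psi_differentiable_x x y : Xset P x -> Yset P y ->
  differentiable (Psi P ^~ y : X -> R^o) x.
Proof. by move=> Cx Cy; apply: (Psi_diffx HP) => //; exact: (Xset_sub HP). Qed.

Lemma Psi_differentiable_y x y : Xset P x -> Yset P y ->
  differentiable (Psi P x : Y -> R^o) y.
Proof. by move=> Cx Cy; apply: (Psi_diffy HP) => //; exact: (Yset_sub HP). Qed.

Lemma Xset_dgf_interior x : Xset P x -> dgf_interior (Xset P) (omegaX P) x.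
Proof. by move=> Cx; split => //; exact: (Xset_int HP). Qed.

Lemma Psi_concave_le x y y' : Xset P x -> Yset P y -> Yset P y' ->
  Psi P x y' <= Psi P x y + grad (Psi P x) y (y' - y).
Proof.
move=> Cx Cy Cy'; have df := Psi_differentiable_y Cx Cy.
have := cvx_first_order (Psi_ccv Cx) Cy Cy' (differentiableN df).
by rewrite gradN//; lra.
Qed.

(** Linearising Psi(., y) at a point x0 bounds psiP(., y) from below by the
    objective of a proximal problem, which attains its minimum; hence
    psiP(., y) is bounded below and [strongly_convex_argmin] applies. *)
Lemma psiP_argmin y : Yset P y -> exists xs, is_argmin (Xset P) (psiP P ^~ y) xs.
Proof.
move=> Cy; have [x0 Cx0] := Xset_neq0 HP.
have mu0 := mu_gt0 HP.
have df v : Xset P v -> differentiable (Psi P ^~ y : X -> R^o) v.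
  by move=> Cv; exact: Psi_differentiable_x.
have dw v : Xset P v -> differentiable (fine \o omegaX P : X -> R^o) v.
  by move=> Cv; apply: (dgf_differentiable (omegaX_dgf HP)); exact: (Xset_int HP).
have [[u [Cu umin]] _] := @prox_problem _ _ _ _ _ CX rfun_cvx (omegaX_dgf HP)
  (prox_solvableX HP) (grad (Psi P ^~ y) x0)
  (fun v => grad (Psi P ^~ y) x0 v + 1 * (fine \o rfun P) v + mu P * fine (omegaX P v) + 0)
  1 (mu P) 0 (linear_form_grad _ _) ltr01 mu0 (fun=> erefl).
apply: (@strongly_convex_argmin _ _ _ _ (mu P / 8)
  (Psi P x0 y - grad (Psi P ^~ y) x0 x0 + (grad (Psi P ^~ y) x0 u
    + 1 * (fine \o rfun P) u + mu P * fine (omegaX P u) + 0))).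
- exact: finite_dimX HP.
- exact: Xset_closed HP.
- exact: CX.
- by exists x0.
- by rewrite divr_gt0.
- move=> a b Ca Cb; rewrite /psiP.
  have h01 : 0 <= (2^-1 : R) <= 1 by apply/andP; split; lra.
  have := Psi_cvx Cy Ca Cb h01; have := rfun_cvx Ca Cb h01.
  have := dgf_strongly_convex (omegaX_dgf HP) Ca Cb h01.
  move=> /(ler_wpM2l (ltW mu0)) /=.
  by move=> c1 c2 c3; lra.
- move=> v Cv; have := umin v Cv.
  have := cvx_first_order (Psi_cvx Cy) Cx0 Cv (df _ Cx0).
  by rewrite gradB /psiP /=; lra.
- move=> l e Cl e0.
  have e3 : 0 < e / 3 by lra.
  have em : 0 < e / 3 / mu P by rewrite divr_gt0.
  have cP : \forall v \near l, `|Psi P l y - Psi P v y| < e / 3.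
    have := @differentiable_continuous _ _ _ _ _ (df _ Cl).
    by move=> /cvgrPdist_lt; apply.
  have cW : \forall v \near l,
      `|fine (omegaX P l) - fine (omegaX P v)| < e / 3 / mu P.
    have := @differentiable_continuous _ _ _ _ _ (dw _ Cl).
    by move=> /cvgrPdist_lt; apply.
  have [V lV HV] : exists2 V, nbhs l V &
      forall v, V v -> ((fine (rfun P l) - e / 3)%:E < rfun P v)%E.
    apply: (r_closed HP); rewrite -[ltRHS](fineK (rfun_fin_num Cl)) lte_fin; lra.
  near=> v; move=> /= Cv.
  have : ((fine (rfun P l) - e / 3)%:E < rfun P v)%E by apply: HV; near: v.
  rewrite -[ltRHS](fineK (rfun_fin_num Cv)) lte_fin => H1.
  have H2 : `|Psi P l y - Psi P v y| < e / 3 by near: v.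
  have H3 : `|fine (omegaX P l) - fine (omegaX P v)| < e / 3 / mu P by near: v.
  rewrite ltr_pdivlMr// in H3.
  have H4 := ler_wpM2l (ltW mu0) (ler_norm (fine (omegaX P l) - fine (omegaX P v))).
  have H5 := ler_norm (Psi P l y - Psi P v y).
  rewrite /psiP; lra.
Unshelve. all: by end_near. Qed.

Lemma dual_piE y xs : is_argmin (Xset P) (psiP P ^~ y) xs ->
  dual_pi P y = psiP P xs y.
Proof. exact: inf_argmin. Qed.

Lemma dual_pi_le x y : Xset P x -> Yset P y -> dual_pi P y <= psiP P x y.
Proof.
move=> Cx Cy; have [xs xsmin] := psiP_argmin Cy.
by rewrite (dual_piE xsmin); exact: xsmin.2.
Qed.

Lemma psiP_growth x y xs : Yset P y -> is_argmin (Xset P) (psiP P ^~ y) xs ->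
  Xset P x -> dual_pi P y + mu P / 2 * `|x - xs| ^+ 2 <= psiP P x y.
Proof.
move=> Cy xsmin Cx; rewrite (dual_piE xsmin).
have ixs := Xset_dgf_interior xsmin.1.
have := argmin_growth (f := psiP P ^~ y) CX (omegaX_dgf HP) (mu_gt0 HP)
  (cvx_onD (Psi_cvx Cy) rfun_cvx) (fun v => erefl _) xsmin ixs Cx.
have := bregman_ge_sqr (omegaX_dgf HP) ixs Cx.
move=> /(ler_wpM2l (ltW (mu_gt0 HP))); move: (bregman _ _ _) => D /=; lra.
Qed.

Lemma psiP_cvx y : Yset P y -> cvx_on (Xset P) (psiP P ^~ y).
Proof.
move=> Cy; apply: cvx_onD; first exact: cvx_onD (Psi_cvx Cy) rfun_cvx.
apply: cvx_onZ; first exact: ltW (mu_gt0 HP).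
exact: strongly_convex_cvx (dgf_strongly_convex (omegaX_dgf HP)).
Qed.

Lemma psiP_concave_le x y y' : Xset P x -> Yset P y -> Yset P y' ->
  psiP P x y' <= psiP P x y + grad (Psi P x) y (y' - y).
Proof. by move=> Cx Cy Cy'; have := Psi_concave_le Cx Cy Cy'; rewrite /psiP; lra. Qed.

(** Let x' minimise psiP(., y') and xs minimise psiP(., y).  Then
    psiP(x', y') is expanded in y around psiP(x', y), which exceeds the
    infimum at y by (mu / 2) |x' - xs|^2.  Replacing the gradient at x' by the
    one at x costs Lxy (|x' - xs| + |xs - x|) |y' - y|; Young's inequality
    charges the first distance to this growth and the second to the accuracy
    e / 2 of x, leaving twice Lxy^2 / (2 mu) |y' - y|^2. *)
Lemma inexact_oracle x y y' e : Xset P x -> Yset P y -> Yset P y' ->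
  psiP P x y - dual_pi P y <= e / 2 ->
  psiP P x y + grad (Psi P x) y (y' - y) - (2 * Lpi P) / 2 * `|y' - y| ^+ 2 - e
  <= dual_pi P y'.
Proof.
move=> Cx Cy Cy' acc.
have mu0 := mu_gt0 HP.
have [xs xsmin] := psiP_argmin Cy; have [x' x'min] := psiP_argmin Cy'.
have Cx' := x'min.1.
rewrite (dual_piE x'min).
have H1 := neg_descent_lipschitz CY (Psi_ccv Cx')
  (fun v Cv => Psi_differentiable_y Cx' Cv) (Psi_lip_yy HP Cx') Cy Cy'.
have H2 := psiP_growth Cy xsmin Cx'.
have H3 := psiP_growth Cy xsmin Cx.
have H4 := grad_dual_norm (y' - y) (Psi_differentiable_y Cx' Cy)
  (Psi_differentiable_y Cx Cy) (Psi_lip_yx HP Cx' Cx Cy).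
set d := `|y' - y| in H1 H4 *; set a := `|x' - xs| in H2; set b := `|x - xs| in H3.
have d0 : 0 <= d by exact: normr_ge0.
have H5 : `|x' - x| <= a + b by rewrite /b (distrC x xs); exact: ler_distD.
have H6 := ler_wpM2r d0 (ler_wpM2l (Lxy_ge0 HP) H5).
have H7 : - (Lxy P * (a + b) * d) <= grad (Psi P x') y (y' - y) - grad (Psi P x) y (y' - y).
  by rewrite lerNl; apply: le_trans (le_trans H4 H6); rewrite -normrN; exact: ler_norm.
(* Young's inequality, used once for each of the two distances to the minimiser. *)
have young (s : R) : Lxy P * s * d <= mu P / 2 * s ^+ 2 + Lxy P ^+ 2 / mu P / 2 * d ^+ 2.
  have : 0 <= (mu P * s - Lxy P * d) ^+ 2 / (2 * mu P).
    by rewrite divr_ge0 ?sqr_ge0// mulr_ge0// ltW.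
  have -> : (mu P * s - Lxy P * d) ^+ 2 / (2 * mu P) =
    mu P / 2 * s ^+ 2 + Lxy P ^+ 2 / mu P / 2 * d ^+ 2 - Lxy P * s * d.
    by field; rewrite gt_eqF.
  by rewrite subr_ge0.
have Ya := young a; have Yb := young b.
have Ld := mulr_ge0 (Lyy_ge0 HP) (sqr_ge0 d).
move: H1 H2 H3 H7 Ya Yb acc Ld; rewrite /Lpi /psiP.
move: (Lxy P ^+ 2 / mu P) => K; move: (dual_pi P y) => pi.
rewrite -/d; lra.
Qed.

End Saddle.

(** * Iteration counts of geometric sequences *)

Section Counting.
Context {R : realType}.
Implicit Types q B x : R.

Lemma ln_ge_invr x : 0 < x -> 1 - x^-1 <= ln x.
Proof.
move=> x0; have x0' : 0 < x^-1 by rewrite invr_gt0.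
have : ln (1 + (x^-1 - 1)) <= x^-1 - 1 by apply: le_ln1Dx; lra.
by rewrite addrC subrK lnV ?posrE//; move: (x^-1) (ln x) => *; lra.
Qed.

(** Take logarithms and use ln (1 + q) >= 1 - 1 / (1 + q), the inverse of
    1 + 1 / q; this bound needs no upper limit on q. *)
Lemma geometric_count q B k : 0 < q -> (1 + q) ^+ k < B ->
  k%:R <= (1 + q^-1) * ln B.
Proof.
move=> q0 kB; have q1 : 0 < 1 + q by lra.
have B0 : 0 < B by apply: lt_trans kB; rewrite exprn_gt0.
have qV : 0 < 1 + q^-1 by rewrite ltr_wpDr// invr_ge0 ltW.
have kln : k%:R * ln (1 + q) <= ln B.
  rewrite mulr_natl -lnXn//; apply: ltW.
  by rewrite ltr_ln ?posrE ?exprn_gt0.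
apply: le_trans (ler_wpM2l (ltW qV) kln).
have kE : (k%:R : R) = (1 + q^-1) * (k%:R * (1 - (1 + q)^-1)).
  by field; rewrite !gt_eqF.
rewrite [leLHS]kE; apply: ler_wpM2l; first exact: ltW.
by apply: ler_wpM2l => //; exact: ln_ge_invr.
Qed.

Lemma geometric_unbounded q B : 0 < q -> exists k, B <= (1 + q) ^+ k.
Proof.
move=> q0.
have bern k : 1 + k%:R * q <= (1 + q) ^+ k.
  elim: k => [|k IH]; first by rewrite expr0 mul0r addr0.
  rewrite exprS -[k.+1]addn1 natrD.
  have := ler_wpM2l (ltW (addr_gt0 ltr01 q0)) IH.
  have : 0 <= k%:R * q * q by rewrite !mulr_ge0// ltW.
  move: (_ ^+ k) (k%:R) => *; lra.
exists (Num.truncn (B / q)).+1; apply: le_trans (bern _).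
have := truncnS_gt (B / q); rewrite ltr_pdivrMr// => H.
by apply: ltW; apply: lt_trans H _; rewrite ltrDr.
Qed.

Lemma sqrt_ratioV (a b : R) : 0 <= a -> 0 <= b ->
  (Num.sqrt (a / b))^-1 = Num.sqrt (b / a).
Proof. by move=> a0 b0; rewrite -sqrtrV ?divr_ge0// invf_div. Qed.

End Counting.

Section Average.
Context {R : realType} {U : normedModType R}.

(** Jensen's inequality for the weights of the method, by induction: each new
    average is the convex combination with weight tau_(t+1) of the previous
    average and the new point. *)
Lemma apg_average (C : set U) (f : U -> R) (x : nat -> U) (th : R) t :
  cvx_set C -> cvx_on C f -> (forall i, C (x i)) ->
  let m := (apg_A th t)^-1 *: \sum_(i < t.+1) apg_alpha th i *: x i in
  C m /\ apg_A th t * f m <= \sum_(i < t.+1) apg_alpha th i * f (x i).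
Proof.
move=> CC Cf Cx /=; elim: t => [|t].
  rewrite !big_ord_recr !big_ord0 /= !add0r apg_A_expr expr0 invr1 !mul1r !scale1r.
  by split.
set m := _^-1 *: _ => -[Cm IH].
have A0 := apg_A_gt0 th t; have A1 := apg_A_gt0 th t.+1.
rewrite ![\sum_(i < t.+2) _]big_ord_recr /=.
have At : apg_A th t.+1 * apg_tau th t.+1 = apg_alpha th t.+1.
  by rewrite mulrC divfK// gt_eqF.
have AS : apg_A th t.+1 * (1 - apg_tau th t.+1) = apg_A th t.
  by rewrite mulrBr mulr1 At apg_AS addrK.
have -> : (apg_A th t.+1)^-1 *: (\sum_(i < t.+1) apg_alpha th i *: x i
    + apg_alpha th t.+1 *: x t.+1) =
    apg_tau th t.+1 *: x t.+1 + (1 - apg_tau th t.+1) *: m.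
  rewrite scalerDr addrC; congr (_ + _).
    by rewrite scalerA /apg_tau mulrC.
  rewrite /m scalerA; congr (_ *: _); rewrite -[X in _ = _ / X]AS.
  have t1 : 1 - apg_tau th t.+1 != 0.
    by apply: contraTneq A0 => t1; rewrite -AS t1 mulr0 ltxx.
  by field; rewrite t1 gt_eqF.
split; first by apply: CC => //; exact: apg_tau01.
have := ler_wpM2l (ltW A1) (Cf _ _ _ (Cx t.+1) Cm (apg_tau01 th t)).
move=> /le_trans; apply; rewrite [leLHS](_ : _ =
  (apg_A th t.+1 * apg_tau th t.+1) * f (x t.+1)
  + (apg_A th t.+1 * (1 - apg_tau th t.+1)) * f m); last by ring.
by rewrite At AS; lra.
Qed.

End Average.

(** * The dual inexact method and its duality gap *)

Section DualApg.
Context {R : realType} {X Y : normedModType R} (P : saddle_problem X Y).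
Variables (x0 : X) (y0 : Y) (eta : R).
Hypotheses (HP : saddle_assumptions P) (Cx0 : Xset P x0)
  (y0int : dgf_interior (Yset P) (omegaY P) y0) (eta0 : 0 < eta)
  (Lxx0 : 0 < Lxx P) (Lpi0 : 0 < Lpi P).

Let CX := Xset_cvx HP.
Let CY := Yset_cvx HP.
Let mu0 := mu_gt0 HP.
Let rho0 := rho_gt0 HP.
Let L2 : 0 < 2 * Lpi P. Proof. exact: mulr_gt0. Qed.
Let x0int := Xset_dgf_interior HP Cx0.
Let ratio := Num.sqrt (2 * Lpi P / rho P).
Let q := Num.sqrt (rho P / (2 * Lpi P)).

Let q0 : 0 < q. Proof. by rewrite sqrtr_gt0 divr_gt0. Qed.
Let qV : q^-1 = ratio. Proof. by rewrite sqrt_ratioV// ltW. Qed.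

Definition is_inner_apg y (b : apg_iterates X) :=
  is_apg (Xset P) (fine \o rfun P) (omegaX P) (mu P) (Lxx P) x0
        (fun k => grad (Psi P ^~ y) (apg_u b k)) b.

Lemma inner_exists y : exists b, is_inner_apg y b.
Proof.
have [b Hb] := apg_exists CX (rfun_cvx HP) (omegaX_dgf HP) (prox_solvableX HP)
  x0 mu0 Lxx0 (fun u => linear_form_grad (Psi P ^~ y) u).
by exists b.
Qed.

Lemma inner_feasible y b k : is_inner_apg y b ->
  Xset P (apg_u b k) /\ Xset P (apg_z b k).
Proof.
move=> Hb.
by have [] := apg_feasible CX (rfun_cvx HP) (omegaX_dgf HP) (prox_solvableX HP)
  mu0 Lxx0 x0int (fun k => linear_form_grad (Psi P ^~ y) (apg_u b k)) Hb k.
Qed.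

Lemma inner_rate y b k xs : Yset P y -> is_inner_apg y b ->
  is_argmin (Xset P) (psiP P ^~ y) xs ->
  psiP P (apg_z b k) y - dual_pi P y
    <= Lxx P * bregman (omegaX P) xs x0 / apg_A (mu P / Lxx P) k.
Proof.
move=> Cy Hb xsmin; rewrite (dual_piE xsmin) lerBlDl.
have Cu i := (inner_feasible i Hb).1.
apply: (apg_rate CX (rfun_cvx HP) (omegaX_dgf HP) (prox_solvableX HP)
  mu0 Lxx0 x0int (H := fun k => Psi P (apg_u b k) y) (h := Psi P ^~ y)
  (fun k => linear_form_grad (Psi P ^~ y) (apg_u b k)) Hb) => [i v Cv|i v Cv|].
- by apply: (cvx_first_order (Psi_cvx HP Cy)) => //; exact: Psi_differentiable_x.
- apply: (descent_lipschitz CX (Psi_cvx HP Cy) _ (Psi_lip_xx HP Cy)) => //.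
  by move=> w Cw; exact: Psi_differentiable_x.
- exact: xsmin.1.
Qed.

Lemma inner_stops y b e : Yset P y -> is_inner_apg y b -> 0 < e ->
  exists k, psiP P (apg_z b k) y - dual_pi P y <= e /\
    forall j, (j < k)%N -> e < psiP P (apg_z b j) y - dual_pi P y.
Proof.
move=> Cy Hb e0; have [xs xsmin] := psiP_argmin HP Cy.
pose D := Lxx P * bregman (omegaX P) xs x0.
pose good k := psiP P (apg_z b k) y - dual_pi P y <= e.
have qx0 : 0 < Num.sqrt (mu P / Lxx P) by rewrite sqrtr_gt0 divr_gt0.
have ex : exists k, good k.
  have [k Hk] := geometric_unbounded (D / e) qx0.
  exists k; apply: le_trans (inner_rate k Cy Hb xsmin) _.
  by rewrite -/D ler_pdivrMr ?apg_A_gt0// mulrC -ler_pdivrMr// apg_A_expr.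
case: (ex_minnP ex) => k gk kmin; exists k; split => // j jk.
by rewrite ltNge; apply/negP => /kmin; rewrite leqNgt jk.
Qed.

Let acc0 : 0 < inner_accuracy P eta.
Proof. by rewrite divr_gt0// mulr_gt0// ltr_wpDr// sqrtr_ge0. Qed.

(** Fixing for each y an inner run and its first accurate iterate makes the
    inexact gradient a function of the query point, so the outer run exists by
    [apg_exists]. *)
Lemma dual_apg_exists : exists a : dual_apg_run X Y, is_dual_apg P eta x0 y0 a.
Proof.
have /choice[ir Hir] := inner_exists.
have /choice[st Hst] : forall y, exists k, Yset P y ->
    psiP P (apg_z (ir y) k) y - dual_pi P y <= inner_accuracy P eta / 2 /\
    forall j, (j < k)%N ->
      inner_accuracy P eta / 2 < psiP P (apg_z (ir y) j) y - dual_pi P y.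
  move=> y; have [Cy|nCy] := pselect (Yset P y); last by exists 0%N.
  have [|k Hk] := inner_stops Cy (Hir y) (e := inner_accuracy P eta / 2).
    by rewrite divr_gt0.
  by exists k.
pose Gam y v := - grad (Psi P (apg_z (ir y) (st y))) y v.
have HGam y : linear_form (Gam y).
  by apply/linear_formP => c u v; rewrite /Gam gradD gradZ; ring.
have [out Ho] := apg_exists CY (gfun_cvx HP) (omegaY_dgf HP) (prox_solvableY HP)
  y0 rho0 L2 HGam.
have Cq t : Yset P (apg_u out t).
  by have [] := apg_feasible CY (gfun_cvx HP) (omegaY_dgf HP) (prox_solvableY HP)
    rho0 L2 y0int (fun t => HGam (apg_u out t)) Ho t.
exists (DualApgRun out (fun t => ir (apg_u out t)) (fun t => st (apg_u out t))).
split => // [t|t|t k].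
- exact: Hir.
- exact: (Hst _ (Cq t)).1.
- exact: (Hst _ (Cq t)).2.
Qed.

Section Run.
Variable a : dual_apg_run X Y.
Hypothesis Ha : is_dual_apg P eta x0 y0 a.

Let G t v := - grad (Psi P (xhat a t)) (query a t) v.
Let HG t : linear_form (G t).
Proof. by apply/linear_formP => c u v; rewrite /G gradD gradZ; ring. Qed.

Lemma outer_feasible t : Yset P (query a t) /\ Yset P (dual_output a t).
Proof.
case: Ha => Ho _ _ _.
by have [] := apg_feasible CY (gfun_cvx HP) (omegaY_dgf HP) (prox_solvableY HP)
    rho0 L2 y0int HG Ho t.
Qed.

Lemma xhat_feasible t : Xset P (xhat a t).
Proof. by case: Ha => _ Hi _ _; exact: (inner_feasible _ (Hi t)).2. Qed.

Lemma primal_output_feasible t : Xset P (primal_output P a t).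
Proof.
exact: (apg_average _ t CX (cvx_on_linear_form (linear_form_grad (fun=> 0) 0))
  xhat_feasible).1.
Qed.

(** At each point v of Yset the models are below - psiP(xhat_i, v) and their
    weighted sum is below - A_t psiP(xbar, v) by Jensen's inequality.  The
    estimate thus bounds psiP(xbar, v) - g(v) - rho omega(v) - d(z_t) for all v
    at once, and the supremum over v is the duality gap. *)
Lemma duality_gap_le M t : dual_radius_le P y0 M ->
  duality_gap P (primal_output P a t) (dual_output a t)
    <= 2 * Lpi P * M / apg_A (rho P / (2 * Lpi P)) t + eta / 2.
Proof.
move=> HM; case: (Ha) => Ho _ acc _.
set th := rho P / (2 * Lpi P).
have A0 := apg_A_gt0 th t.
have Cq i := (outer_feasible i).1; have Cz := (outer_feasible t).2.
have Cxh := xhat_feasible.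
have concave i v : Yset P v ->
    - psiP P (xhat a i) (query a i) + G i (v - query a i) <= - psiP P (xhat a i) v.
  by move=> Cv; have := psiP_concave_le HP (Cxh i) (Cq i) Cv; rewrite /G; lra.
have lower i v : Yset P v ->
    - psiP P (xhat a i) (query a i) + G i (v - query a i) <= - dual_pi P v.
  move=> Cv; apply: le_trans (concave i v Cv) _.
  by rewrite lerN2; exact: dual_pi_le.
have upper i v : Yset P v -> - dual_pi P v <=
    - psiP P (xhat a i) (query a i) + G i (v - query a i)
      + (2 * Lpi P) / 2 * `|v - query a i| ^+ 2 + inner_accuracy P eta.
  by move=> Cv; have := inexact_oracle HP (Cxh i) (Cq i) Cv (acc i); rewrite /G; lra.
set z := dual_output a t; set xb := primal_output P a t.
have main v : Yset P v ->
    psiP P xb v - gfun P v - rho P * fine (omegaY P v) - dual_value P z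
    <= 2 * Lpi P * M / apg_A th t + eta / 2.
  move=> Cv.
  have /= := apg_estimate CY (gfun_cvx HP) (omegaY_dgf HP) (prox_solvableY HP)
    rho0 L2 y0int HG Ho (h := fun y => - dual_pi P y)
    (H := fun i => - psiP P (xhat a i) (query a i)) (eps := inner_accuracy P eta)
    lower upper t Cv.
  rewrite -/z -/th => est.
  have [_ avg] := apg_average th t CX (psiP_cvx HP Cv) Cxh.
  have models : \sum_(i < t.+1) apg_alpha th i *
      (- psiP P (xhat a i) (query a i) + G i (v - query a i))
      <= - (apg_A th t * psiP P xb v).
    rewrite lerNr; apply: le_trans avg _; rewrite -sumrN.
    apply: ler_sum => i _; rewrite -mulrN.
    apply: ler_wpM2l; first exact: apg_alpha_ge0.
    by rewrite lerNr concave.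
  (* The inner accuracy is eta / 2 divided by the amplification factor. *)
  have errors : inner_accuracy P eta * \sum_(i < t.+1) apg_A th i
      <= apg_A th t * (eta / 2).
    apply: le_trans (ler_wpM2l (ltW acc0) (apg_A_sum t q0)) _.
    rewrite -/q qV /inner_accuracy -/ratio le_eqVlt; apply/orP; left; apply/eqP.
    by field; rewrite gt_eqF// ltr_wpDr// sqrtr_ge0.
  have radius := ler_wpM2l (ltW L2) (HM v Cv).
  have quot : apg_A th t * (2 * Lpi P * M / apg_A th t) = 2 * Lpi P * M.
    by rewrite mulrC divfK// gt_eqF.
  rewrite -(ler_pM2l A0) [leRHS]mulrDr quot /dual_value.
  move: est models errors radius.
  rewrite /query; move: (\sum_(i < t.+1) _ * _) (_ * \sum_(i < t.+1) _) => s1 s2.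
  move: (bregman _ _ _) => D; lra.
rewrite /duality_gap /primal_value.
suff : fbar P xb <= 2 * Lpi P * M / apg_A th t + eta / 2 + dual_value P z
    - fine (rfun P xb) - mu P * fine (omegaX P xb) by lra.
apply: ge_sup.
  exists (Psi P xb y0 - gfun P y0 - rho P * fine (omegaY P y0)), y0 => //.
  by case: y0int.
by move=> _ [v /main + <-]; rewrite /psiP; lra.
Qed.

End Run.
End DualApg.

(** * Complexity bounds *)

Section Complexity.
Context {R : realType} {X Y : normedModType R} (P : saddle_problem X Y).
Variables (x0 : X) (y0 : Y) (eta M : R).
Hypotheses (HP : saddle_assumptions P) (Cx0 : Xset P x0)
  (y0int : dgf_interior (Yset P) (omegaY P) y0) (eta0 : 0 < eta)
  (Lxx0 : 0 < Lxx P) (Lpi0 : 0 < Lpi P).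
Variable a : dual_apg_run X Y.
Hypothesis Ha : is_dual_apg P eta x0 y0 a.

(** For t take the first index with A_t >= 4 Lpi M / eta; if t > 0, then
    [geometric_count] applies to t - 1. *)
Lemma gap_count : dual_radius_le P y0 M ->
  exists t, duality_gap P (primal_output P a t) (dual_output a t) <= eta /\
    forall Lam, 0 <= Lam -> ln (4 * Lpi P * M / eta) <= Lam ->
      t%:R <= 1 + (1 + Num.sqrt (2 * Lpi P / rho P)) * Lam.
Proof.
move=> HM; have rho0 := rho_gt0 HP.
have L2 : 0 < 2 * Lpi P by exact: mulr_gt0.
pose q := Num.sqrt (rho P / (2 * Lpi P)).
have q0 : 0 < q by rewrite sqrtr_gt0 divr_gt0.
pose B := 4 * Lpi P * M / eta.
have ex := geometric_unbounded B q0.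
case: (ex_minnP ex) => t Bt tmin; exists t; split.
  apply: le_trans (duality_gap_le HP Cx0 y0int eta0 Lxx0 Lpi0 Ha t HM) _.
  suff : 2 * Lpi P * M / apg_A (rho P / (2 * Lpi P)) t <= eta / 2 by lra.
  rewrite apg_A_expr -/q; move: Bt; rewrite /B ler_pdivrMr// => Bt.
  rewrite ler_pdivrMr ?exprn_gt0 ?addr_gt0//; move: (_ ^+ t) Bt => *; lra.
move=> Lam Lam0 lnB; case: t Bt tmin => [|t] _ tmin.
  by rewrite addr_ge0// mulr_ge0// addr_ge0// sqrtr_ge0.
have tB : (1 + q) ^+ t < B.
  by rewrite ltNge; apply/negP => /tmin; rewrite ltnn.
rewrite -addn1 natrD addrC lerD2l; apply: le_trans (geometric_count q0 tB) _.
rewrite (sqrt_ratioV (ltW rho0) (ltW L2)).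
by apply: ler_wpM2l => //; rewrite addr_ge0// sqrtr_ge0.
Qed.

(** The last iterate before stopping is still inaccurate, which bounds
    A_k from above by [inner_rate]. *)
Lemma inner_stop_le Lam i : primal_radius_le P x0 M -> 0 <= Lam ->
  ln (Lxx P * M / (inner_accuracy P eta / 2)) <= Lam ->
  (inner_stop a i)%:R <= 1 + (1 + Num.sqrt (Lxx P / mu P)) * Lam.
Proof.
move=> HM Lam0 lnB; have mu0 := mu_gt0 HP.
case: (Ha) => _ Hi _ /(_ i) Hstop.
have Cq := (outer_feasible HP y0int Lpi0 Ha i).1.
have [xs xsmin] := psiP_argmin HP Cq.
have q0 : 0 < Num.sqrt (mu P / Lxx P) by rewrite sqrtr_gt0 divr_gt0.
case: (inner_stop a i) Hstop => [|k] Hstop.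
  by rewrite addr_ge0// mulr_ge0// addr_ge0// sqrtr_ge0.
have acc0 : 0 < inner_accuracy P eta / 2.
  by rewrite !divr_gt0// mulr_gt0// ltr_wpDr// sqrtr_ge0.
have kB : (1 + Num.sqrt (mu P / Lxx P)) ^+ k < Lxx P * M / (inner_accuracy P eta / 2).
  rewrite ltr_pdivlMr// -apg_A_expr mulrC -ltr_pdivlMr ?apg_A_gt0//.
  apply: lt_le_trans (Hstop k (ltnSn k)) _.
  apply: le_trans (inner_rate HP Cx0 Lxx0 k Cq (Hi i) xsmin) _.
  rewrite ler_pM2r ?invr_gt0 ?apg_A_gt0// ler_pM2l//.
  exact: HM Cq xsmin.
rewrite -addn1 natrD addrC lerD2l; apply: le_trans (geometric_count q0 kB) _.
rewrite (sqrt_ratioV (ltW mu0) (ltW Lxx0)).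
by apply: ler_wpM2l => //; rewrite addr_ge0// sqrtr_ge0.
Qed.

Lemma Lpi_ratio_le : Lpi P / rho P <= cond_dual P ^+ 2.
Proof.
have mu0 := mu_gt0 HP; have rho0 := rho_gt0 HP.
rewrite /cond_dual /Lpi.
have -> : (Lyy P + Lxy P ^+ 2 / mu P) / rho P =
    Num.sqrt (Lyy P / rho P) ^+ 2 + (Lxy P / Num.sqrt (mu P * rho P)) ^+ 2.
  rewrite sqr_sqrtr ?divr_ge0 ?(Lyy_ge0 HP) ?ltW// expr_div_n sqr_sqrtr; last first.
    by rewrite mulr_ge0// ltW.
  by field; rewrite !gt_eqF.
rewrite sqrrD; set s := Num.sqrt (Lyy P / rho P); set T := Lxy P / _.
have : 0 <= s * T.
  by rewrite mulr_ge0 ?sqrtr_ge0// divr_ge0 ?sqrtr_ge0// (Lxy_ge0 HP).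
by rewrite mulr2n; lra.
Qed.

Lemma cond_dual_ge0 : 0 <= cond_dual P.
Proof. by rewrite addr_ge0 ?sqrtr_ge0// divr_ge0 ?sqrtr_ge0// (Lxy_ge0 HP). Qed.

Lemma ratio_le_cond_dual : Num.sqrt (2 * Lpi P / rho P) <= 2 * cond_dual P.
Proof.
have rho0 := rho_gt0 HP.
rewrite -(ler_pXn2r (n := 2))// ?nnegrE ?sqrtr_ge0 ?mulr_ge0 ?cond_dual_ge0//.
rewrite sqr_sqrtr; last by rewrite divr_ge0 ?mulr_ge0 ?ltW.
have := Lpi_ratio_le; have := divr_gt0 Lpi0 rho0.
by rewrite exprMn -mulrA; move: (Lpi P / rho P) => *; lra.
Qed.

End Complexity.

(** Additive constants are absorbed by 2 <= 4 c Lam and Lam <= c Lam. *)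
Lemma dual_cost (R : realType) (t c s Lam : R) :
  1 <= c -> 2^-1 <= Lam -> s <= 2 * c -> t <= 1 + (1 + s) * Lam ->
  t + 1 <= 7 * (c * Lam).
Proof.
move=> c1 Lam2 sc tle.
have Lam0 : 0 <= Lam by lra.
have := ler_wpM2r Lam0 sc; have := ler_wpM2r Lam0 c1.
have := ler_wpM2l (ltW (lt_le_trans ltr01 c1)) Lam2; lra.
Qed.

(** Here 2 + Lam <= 5 Lam <= 5 (Q / c) Lam; the lower bound c for Q is what
    keeps the cost of at least one step per inner run proportional to Q. *)
Lemma primal_cost (R : realType) (k c Q Lam : R) :
  0 < c -> c <= Q -> 2^-1 <= Lam -> k <= 1 + (1 + Q) * Lam ->
  k + 1 <= (1 + 5 / c) * (Q * Lam).
Proof.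
move=> c0 cQ Lam2 kle; have Lam0 : 0 <= Lam by lra.
have cQ' : 1 <= Q / c by rewrite ler_pdivlMr// mul1r.
have -> : (1 + 5 / c) * (Q * Lam) = Q * Lam + 5 * ((Q / c) * Lam) by field; rewrite gt_eqF.
have := ler_wpM2r Lam0 cQ'; move: (Q / c) => *; lra.
Qed.

Section Thresholds.
Context {R : realType}.

(** The bound 1 / 2 on eta and rho keeps the logarithm above 1 / 2, and
    rho <= 1 / M makes the condition number at least 1; the last two bounds on
    rho absorb the constants inside the logarithms. *)
Definition small_threshold (M : R) : R :=
  Num.min (Num.min 2^-1 M^-1) (Num.min (8 * M ^+ 2)^-1 (128 * M ^+ 5)^-1).

Lemma small_threshold_gt0 M : 0 < M -> 0 < small_threshold M.
Proof.
by move=> M0; rewrite !lt_min !invr_gt0 !mulr_gt0 ?exprn_gt0 ?M0//= ?ltr0n.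
Qed.

Lemma ln_le_target (e r B : R) : 0 < e -> 0 < r -> 0 < B -> B * r <= 1 ->
  ln (B / e) <= ln ((e * r)^-1).
Proof.
move=> e0 r0 B0 Br; rewrite ler_ln ?posrE ?divr_gt0 ?invr_gt0 ?mulr_gt0//.
by rewrite invfM mulrC ler_pM2l ?invr_gt0// -[r^-1]mul1r ler_pdivlMr.
Qed.

Lemma small_parameters (M e r L l : R) : 0 < M -> 0 < e -> 0 < r ->
  e <= small_threshold M -> r <= small_threshold M ->
  0 < L <= M -> 0 < l <= M ->
  [/\ 2^-1 <= ln ((e * r)^-1),
      ln (4 * L * M / e) <= ln ((e * r)^-1),
      ln (l * M / (e / (2 * (1 + Num.sqrt (2 * L / r))) / 2)) <= ln ((e * r)^-1) &
      r <= M^-1].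
Proof.
move=> M0 e0 r0; rewrite !le_min -!andbA.
move=> /and4P[e1 _ _ _] /and4P[r1 r2 r3 r4] /andP[L0 LM] /andP[l0 lM].
have M2 : 0 < 8 * M ^+ 2 by rewrite mulr_gt0 ?exprn_gt0.
have M5 : 0 < 128 * M ^+ 5 by rewrite mulr_gt0 ?exprn_gt0.
have {}r3 : 8 * M ^+ 2 * r <= 1 by rewrite mulrC -ler_pdivlMr// mul1r.
have {}r4 : 128 * M ^+ 5 * r <= 1 by rewrite mulrC -ler_pdivlMr// mul1r.
have LMM : L * M <= M ^+ 2 by rewrite expr2 ler_pM2r.
have lMM : l * M <= M ^+ 2 by rewrite expr2 ler_pM2r.
set s := Num.sqrt (2 * L / r); have s0 : 0 <= s by exact: sqrtr_ge0.
split => //.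
- have er : e * r <= 2^-1.
    by apply: le_trans (_ : 2^-1 * 1 <= _); [apply: ler_pM => //; rewrite ?ltW//; lra|lra].
  have := ln_ge_invr (x := (e * r)^-1); rewrite invr_gt0 mulr_gt0// invrK => /(_ isT).
  by apply: le_trans; lra.
- apply: ln_le_target => //; first by rewrite !mulr_gt0// (lt_le_trans L0).
  apply: le_trans r3; rewrite ler_pM2r//; have := exprn_gt0 2 M0; lra.
- have s1 : 0 < 1 + s by lra.
  have -> : l * M / (e / (2 * (1 + s)) / 2) = 4 * (1 + s) * (l * M) / e.
    by field; rewrite !gt_eqF.
  apply: ln_le_target => //; first by rewrite !mulr_gt0// (lt_le_trans l0).
  have sr : 8 * M ^+ 2 * (s * r) <= 1.
    have sr0 : 0 <= 8 * M ^+ 2 * (s * r) by rewrite !mulr_ge0 ?sqr_ge0// ltW.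
    have Lr0 : 0 <= 2 * L / r by rewrite divr_ge0 ?mulr_ge0// ltW.
    rewrite -(ler_pXn2r (n := 2)) ?nnegrE// expr1n !exprMn sqr_sqrtr//.
    have -> : 8 ^+ 2 * (M ^+ 2) ^+ 2 * (2 * L / r * r ^+ 2) = 128 * M ^+ 4 * r * L.
      by field; rewrite gt_eqF.
    apply: le_trans r4; have -> : 128 * M ^+ 5 * r = 128 * M ^+ 4 * r * M by ring.
    by rewrite ler_pM2l// !mulr_gt0 ?exprn_gt0.
  have s1r : 0 <= 4 * ((1 + s) * r) by rewrite !mulr_ge0// ltW.
  have := ler_wpM2l s1r lMM.
  move: r3 sr; lra.
Qed.

End Thresholds.

(* Cd and Cp are the constants hidden in the O-bounds; they do not depend on the
   problem, except that Cp depends on a lower bound kappa of L'_xx / mu. The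
   bound M on the quantities suppressed inside the logarithms only influences
   the threshold e0 below which eta and rho count as small. *)
Theorem corollary6p3 (R : realType) :
  exists2 Cd : R, 0 < Cd &
  forall kappa : R, 0 < kappa ->
  exists2 Cp : R, 0 < Cp &
  forall M : R, 0 < M ->
  exists2 e0 : R, 0 < e0 &
  forall (X Y : normedModType R) (P : saddle_problem X Y)
         (x0 : X) (y0 : Y) (eta : R),
    saddle_assumptions P ->
    Xset P x0 ->
    dgf_interior (Yset P) (omegaY P) y0 ->
    0 < eta ->
    kappa * mu P <= Lxx P ->
    Lxx P <= M ->
    M^-1 <= Lpi P <= M ->
    dual_radius_le P y0 M ->
    primal_radius_le P x0 M ->
    (exists a : dual_apg_run X Y, is_dual_apg P eta x0 y0 a) /\
    forall a : dual_apg_run X Y, is_dual_apg P eta x0 y0 a ->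
      exists t : nat,
        [/\ Xset P (primal_output P a t),
            Yset P (dual_output a t),
            duality_gap P (primal_output P a t) (dual_output a t) <= eta &
            eta <= e0 -> rho P <= e0 ->
              (dual_evals a t)%:R <=
                Cd * (cond_dual P * ln ((eta * rho P)^-1)) /\
              (primal_evals a t)%:R <=
                Cp * (cond_dual P * Num.sqrt (Lxx P / mu P)
                      * ln ((eta * rho P)^-1) ^+ 2)].
Proof.
exists 7 => // kappa kappa0.
pose c := Num.sqrt kappa; have c0 : 0 < c by rewrite sqrtr_gt0.
exists (7 * (1 + 5 / c)); first by rewrite mulr_gt0// addr_gt0// divr_gt0.
move=> M M0; exists (small_threshold M); first exact: small_threshold_gt0.
move=> X Y P x0 y0 eta HP Cx0 y0int eta0 kLxx LxxM /andP[LpiM' LpiM] HMd HMp.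
have mu0 := mu_gt0 HP; have rho0 := rho_gt0 HP.
have Lxx0 : 0 < Lxx P by apply: lt_le_trans kLxx; exact: mulr_gt0.
have Lpi0 : 0 < Lpi P by apply: lt_le_trans LpiM'; rewrite invr_gt0.
split; first exact: dual_apg_exists.
move=> a Ha; pose Lam := ln ((eta * rho P)^-1).
have [t [gap tle]] := gap_count HP Cx0 y0int eta0 Lxx0 Lpi0 Ha HMd.
exists t; split => //.
- exact: (primal_output_feasible HP Cx0 Lxx0 Ha).
- exact: (outer_feasible HP y0int Lpi0 Ha t).2.
move=> eta_small rho_small.
have [Lam2 logd logp rhoM] : [/\ 2^-1 <= Lam, ln (4 * Lpi P * M / eta) <= Lam,
    ln (Lxx P * M / (inner_accuracy P eta / 2)) <= Lam & rho P <= M^-1].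
  by apply: small_parameters; rewrite ?Lpi0 ?Lxx0.
have Lam0 : 0 <= Lam by lra.
rewrite -/Lam.
have cond1 : 1 <= cond_dual P.
  rewrite -(ler_pXn2r (n := 2))// ?nnegrE ?cond_dual_ge0// expr1n.
  apply: le_trans (Lpi_ratio_le HP); rewrite ler_pdivlMr// mul1r.
  exact: le_trans rhoM LpiM'.
have cond0 := cond_dual_ge0 HP.
have dcost : t%:R + 1 <= 7 * (cond_dual P * Lam).
  exact: dual_cost cond1 Lam2 (ratio_le_cond_dual HP Lpi0) (tle _ Lam0 logd).
have dcost' : (dual_evals a t)%:R <= 7 * (cond_dual P * Lam).
  by rewrite /dual_evals -addn1 natrD.
split => //.
set Q := Num.sqrt (Lxx P / mu P).
have cQ : c <= Q by rewrite ler_wsqrtr// ler_pdivlMr.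
pose K := (1 + 5 / c) * (Q * Lam).
have K0 : 0 <= K.
  rewrite !mulr_ge0 ?sqrtr_ge0// addr_ge0// divr_ge0// ltW//.
have pcost i : (inner_stop a i).+1%:R <= K.
  rewrite -addn1 natrD; apply: (primal_cost c0 cQ Lam2).
  exact: (inner_stop_le HP Cx0 y0int eta0 Lxx0 Lpi0 Ha i HMp Lam0 logp).
rewrite /primal_evals natr_sum.
apply: le_trans (_ : \sum_(i < t.+1) K <= _).
  by apply: ler_sum => i _; exact: pcost.
rewrite sumr_const card_ord -[K *+ _]mulr_natl.
apply: le_trans (ler_wpM2r K0 (dcost' : t.+1%:R <= _)) _.
by rewrite /K le_eqVlt; apply/orP; left; apply/eqP; rewrite expr2; ring.
Qed.
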